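(* Let $G=(V,E)$ be any simple, undirected, locally finite and connected graph. Let $\{\langle X_t,G_t\rangle\}_{t\ge 0}$, with $G_t=(V,E,C_t)$, be any proper and bounded from above RWCE on $G$, and let $R_t(e):=1/C_t(e)$ for $e\in E$, $t\ge 0$. Assume that $$\Gamma:=\sum_{t\ge 0,\ e\in E}|R_t(e)-R_{t+1}(e)|<\infty$$ almost surely. Then the RWCE $\{\langle X_t,G_t\rangle\}_{t\ge 0}$ is recurrent (resp. transient), provided the weighted random walk on $(G,C_0)$ is recurrent (resp. transient).
   Context: Let $G=(V,E)$ be a simple, undirected, locally finite (all degrees finite), connected graph; $x\sim y$ means $x,y$ are neighbours. For a weight configuration $C\in[0,\infty)^E$ write $C(x,y)=C(y,x)$ for the weight of edge $\{x,y\}$ and $P(x,y;C):=\frac{C(x,y)}{\sum_{z:z\sim x}C(x,z)}\mathbf 1_{(x\sim y)}$. A Random Walk in Changing Environment (RWCE) on $G$ is a stochastic process $\{\langle X_t,G_t\rangle\}_{t=0}^\infty$ on a probability space $(\Omega,\mathscr F,\mathbb P)$, where $X_t:\Omega\to V$ is measurable and $G_t=(V,E,C_t)$ with $C_t:\Omega\to[0,\infty)^E$ measurable (random weights), such that for all $t\in\{0,1,2,\dots\}$ and $y\in V$, $\mathbb P[X_{t+1}=y\mid\mathscr F_t]=P(X_t,y;C_t)$ almost surely, where $\mathscr F_t:=\sigma(\langle X_s,G_s\rangle: s=0,\dots,t)$. The weights $C_t$ may depend on the history of the process and on extra randomness. The RWCE is proper if $C_t(e)\in(0,\infty)$ for all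 $e\in E$, $t\ge0$. It is bounded from above if, almost surely, $\sup_{t\ge0}C_t(e)<\infty$ for all $e\in E$. An RWCE is recurrent if almost surely every vertex is visited infinitely often by $\{X_t\}$; it is transient if almost surely every vertex is visited finitely often. The weighted random walk on $(G,C)$, for fixed $C\in(0,\infty)^E$, is the Markov chain on $V$ with transition probabilities $P(x,y;C)$. For a random weight configuration $C_0$, the weighted random walk on $(G,C_0)$ is said to be recurrent (resp. transient) if the weighted random walk, conditional on $C_0$, is recurrent (resp. transient) almost surely. *)

(* Defs.v *)
From HB Require Import structures.
From mathcomp Require Import all_boot all_order all_algebra.
From mathcomp Require Import finmap.
From mathcomp Require Import all_classical all_reals all_analysis.

Set Implicit Arguments.
Unset Strict Implicit.
Unset Printing Implicit Defensive.

Import Order.TTheory GRing.Theory Num.Theory.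
Import numFieldNormedType.Exports.

Local Open Scope classical_set_scope.
Local Open Scope ring_scope.

Section Graph.
Variables (V : choiceType) (adj : rel V).

Definition simple_graph : Prop := symmetric adj /\ irreflexive adj.

Definition locally_finite : Prop :=
  forall x : V, finite_set [set y | adj x y].

Definition connected_graph : Prop :=
  forall x y : V, exists p : seq V, path adj x p /\ last x p = y.

(* An edge is the unordered pair of its endpoints, as a finite set. *)
Definition edges : set {fset V} :=
  [set e | exists x y : V, adj x y /\ e = [fset x; y]%fset].

(* A weight configuration is a function on {fset V}; only its values on
   [edges] are ever used. *)
Definition trans_prob (R : realType) (C : {fset V} -> R) (x y : V) : R :=
  if adj x y then C [fset x; y]%fset / \sum_(z \in [set z | adj x z]) C [fset x; z]%fset
  else 0.

End Graph.

Section Process.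
Variables (R : realType) (d : measure_display) (Omega : measurableType d).
Variables (P : probability Omega R) (V : choiceType) (X : nat -> Omega -> V).

(* V carries the discrete sigma-algebra. *)
Definition discrete_rv (Y : Omega -> V) : Prop :=
  forall U : set V, measurable (Y @^-1` U).

Definition recurrent : Prop :=
  {ae P, forall w, forall v : V, infinite_set [set t | X t w = v]}.

Definition transient : Prop :=
  {ae P, forall w, forall v : V, finite_set [set t | X t w = v]}.

(* X is a Markov chain started at x with transition probabilities p; the
   conditional probabilities given {X_0 = u_0, ..., X_n = u_n} are cleared of
   their denominators. *)
Definition markov_chain (p : V -> V -> R) (x : V) : Prop :=
  [/\ forall t, discrete_rv (X t),
      P [set w | X 0%N w = x] = 1%E &
      forall (n : nat) (u : nat -> V),
        P [set w | forall s, (s <= n.+1)%N -> X s w = u s] =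
        (P [set w | forall s, (s <= n)%N -> X s w = u s] *
         (p (u n) (u n.+1))%:E)%E].

End Process.

Section WeightedWalk.
Variables (V : choiceType) (adj : rel V) (R : realType) (C : {fset V} -> R).

(* The law of the chain started at x is determined by x and C, so it does not
   matter which realization of the chain is taken. *)
Definition walk_recurrent : Prop :=
  forall x : V, exists (d : measure_display) (Omega : measurableType d)
    (P : probability Omega R) (X : nat -> Omega -> V),
    markov_chain P X (trans_prob adj C) x /\ recurrent P X.

Definition walk_transient : Prop :=
  forall x : V, exists (d : measure_display) (Omega : measurableType d)
    (P : probability Omega R) (X : nat -> Omega -> V),
    markov_chain P X (trans_prob adj C) x /\ transient P X.

End WeightedWalk.

Section RWCE.
Variables (R : realType) (d : measure_display) (Omega : measurableType d).
Variables (P : probability Omega R) (V : choiceType) (adj : rel V).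
Variables (X : nat -> Omega -> V) (C : nat -> Omega -> {fset V} -> R).

(* sigma(<X_s, G_s> : s <= t), with the product sigma-algebra on the weights *)
Definition history (t : nat) : set (set Omega) :=
  <<s [set A | exists s : nat, (s <= t)%N /\
        ((exists U : set V, A = X s @^-1` U) \/
         (exists (e : {fset V}) (B : set R), [/\ edges adj e, measurable B &
            A = (fun w => C s w e) @^-1` B]))] >>.

(* Y is a version of the conditional probability P[B | F]. *)
Definition is_cond_prob (F : set (set Omega)) (B : set Omega)
    (Y : Omega -> R) : Prop :=
  (forall S : set R, measurable S -> F (Y @^-1` S)) /\
  (forall A : set Omega, F A -> (\int[P]_(w in A) (Y w)%:E = P (A `&` B))%E).

Definition is_RWCE : Prop :=
  [/\ forall t, discrete_rv (X t),
      forall t e, edges adj e -> measurable_fun setT (fun w => C t w e),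
      forall t w e, edges adj e -> 0 <= C t w e &
      forall t y, is_cond_prob (history t) [set w | X t.+1 w = y]
                    (fun w => trans_prob adj (C t w) (X t w) y)].

Definition proper_RWCE : Prop :=
  forall t w e, edges adj e -> 0 < C t w e.

Definition bounded_from_above : Prop :=
  {ae P, forall w, forall e, edges adj e ->
    (ereal_sup [set (C t w e)%:E | t in [set: nat]] < +oo)%E}.

(* Gamma, the total variation over time of the resistances R_t(e) = 1/C_t(e) *)
Definition resistance_variation (w : Omega) : \bar R :=
  \esum_(te in [set: nat] `*` edges adj)
    `|(C te.1 w te.2)^-1 - (C te.1.+1 w te.2)^-1|%:E.

End RWCE.

(* Main.v *)
Require Import Defs.
From HB Require Import structures.
From mathcomp Require Import all_boot all_order all_algebra.
From mathcomp Require Import finmap.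
From mathcomp Require Import all_classical all_reals all_analysis.
From mathcomp Require Import measurable_realfun.
From mathcomp Require Import ring lra.

(** Let W be a finite set of vertices and let v be the voltage in the network
with conductances C when a unit current enters at x and leaves through the
complement of W, which is grounded; so v is the Green function at x of the walk
killed outside W, divided by the total conductance at x, and v(x) is the
effective resistance between x and the complement of W.  Write v_t for the
voltage in the random network at time t, and R_t = 1/C_t.

Inside W, and given the past up to time t, the value v_t(X_t) keeps its mean
over one step of the walk, except at x, where it loses the inverse of the total
conductance (lemma drift).  The next step uses the weights C_t+1, and this is
harmless: if u, u' are the voltages for the resistances R, R', then u'(y) - u(y)
is the sum over the edges of (R' - R) * theta * theta', where theta and theta'
are unit current flows, with values in [-1, 1] by the cut argument of
green_flow_le1.  Hence the replacement of R by R' moves the voltage by at most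
the total variation of the resistances, uniformly in W (green_stable).  So
v_t(X_t), minus the variation used so far, is a supermartingale, and a bound on
Gamma makes all the estimates uniform in W.

Two estimates follow.  If the effective resistance from x to the complement of
W_n is bounded in n, then the mean of the number of visits to x, each weighted
by an inverse conductance, is finite as long as the walk stays in the union of
the W_n; the conductances at x being bounded in time, x is visited finitely
often (finite_visits).  If instead the effective resistance from o to the
complement of the balls is unbounded, then v_t(o) - v_t(X_t), a nonnegative
martingale away from o up to the same correction, starts below the resistance of
a fixed path and is as large as this effective resistance when the walk leaves
the ball; so the walk does not leave all the balls without a visit to o
(no_escape).

Transience is finite_visits for the balls W_n around x.  For recurrence, take
for W_n the balls without o: the effective resistance from any x is then at most
the resistance of a path from x to o, so a walk that avoids o visits every
vertex finitely often, hence leaves every ball, contrary to no_escape; a shift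
of time gives infinitely many visits.  Finally, the hypothesis on the weighted
random walk on (G, C_0) enters through the same two results, for constant
weights: a recurrent walk cannot have bounded effective resistances to the
complement of the balls, and a transient one cannot have unbounded ones
(walk_recurrent_green, walk_transient_green). *)

Set Implicit Arguments.
Unset Strict Implicit.
Unset Printing Implicit Defensive.

Import Order.TTheory GRing.Theory Num.Theory.
Import numFieldNormedType.Exports.

Local Open Scope classical_set_scope.
Local Open Scope ring_scope.

(** * Voltages in a finite part of a network *)

Section Potential.
Variables (V : choiceType) (adj : rel V) (R : realType).
Implicit Types (c : V -> V -> R) (f k : V -> R) (W N : {fset V}) (x y z : V).

Definition nb z : {fset V} := fset_set [set y | adj z y].

Definition nbhd W : {fset V} := (W `|` \bigcup_(z <- W) nb z)%fset.

(** Vanishing off the edges lets Laplacians and energies be summed over any finite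
set of vertices that contains the relevant neighbours. *)
Definition network c : Prop :=
  [/\ forall a b, c a b = c b a, forall a b, adj a b -> 0 < c a b
    & forall a b, ~~ adj a b -> c a b = 0].

Definition lap c f z : R := \sum_(y <- nb z) c z y * (f z - f y).

Hypotheses (hsimple : simple_graph adj) (hfin : locally_finite adj)
  (hconn : connected_graph adj).

Lemma in_nb z y : (y \in nb z) = adj z y.
Proof.
rewrite /nb in_fset_set; last exact: hfin.
by apply/idP/idP; rewrite in_setE.
Qed.

Lemma sub_nbhd W : (W `<=` nbhd W)%fset.
Proof. exact: fsubsetUl. Qed.

Lemma nb_sub_nbhd W z : z \in W -> (nb z `<=` nbhd W)%fset.
Proof.
move=> zW; apply: (@fsubset_trans _ (\bigcup_(z <- W) nb z)%fset).
  exact: bigfcup_sup.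
exact: fsubsetUr.
Qed.

Lemma sum_nb (F : V -> R) z N : (nb z `<=` N)%fset ->
  (forall y, ~~ adj z y -> F y = 0) ->
  \sum_(y <- nb z) F y = \sum_(y <- N) F y.
Proof.
by move=> nbN F0; apply: big_fset_incl => // y yN; rewrite in_nb; exact: F0.
Qed.

Lemma lapE c f z N : network c -> (nb z `<=` N)%fset ->
  lap c f z = \sum_(y <- N) c z y * (f z - f y).
Proof.
by move=> [_ _ c0] nbN; apply: sum_nb => // y /c0 ->; rewrite mul0r.
Qed.

Lemma lapN c f z : lap c (fun y => - f y) z = - lap c f z.
Proof. by rewrite /lap -sumrN; apply: eq_bigr => y _; ring. Qed.

Lemma lapB c f k z : lap c (fun y => f y - k y) z = lap c f z - lap c k z.
Proof. by rewrite /lap -sumrB; apply: eq_bigr => y _; ring. Qed.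

Lemma lap_cst c z a : lap c (fun=> a) z = 0.
Proof. by rewrite /lap big1// => y _; rewrite subrr mulr0. Qed.

(** The total current out of S: the contributions of pairs inside S cancel. *)
Lemma lap_cut c f (S : pred V) N : network c ->
  (forall z, S z -> (nb z `<=` N)%fset) ->
  \sum_(z <- N | S z) lap c f z =
  \sum_(z <- N | S z) \sum_(y <- N | ~~ S y) c z y * (f z - f y).
Proof.
move=> nc SN; have [csym _ _] := nc.
rewrite (eq_bigr (fun z => \sum_(y <- N | S y) c z y * (f z - f y) +
    \sum_(y <- N | ~~ S y) c z y * (f z - f y))); last first.
  by move=> z Sz; rewrite (lapE _ nc (SN z Sz))// (bigID S).
rewrite big_split/= [X in X + _](_ : _ = 0) ?add0r//.
set T := LHS; suff : T = - T by lra.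
rewrite {1}/T exchange_big/= -sumrN; apply: eq_bigr => z _.
by rewrite -sumrN; apply: eq_bigr => y _; rewrite csym; ring.
Qed.

Lemma term_le_sum (N : {fset V}) (S : pred V) (F : V -> R) a : a \in N -> S a ->
  (forall y, S y -> 0 <= F y) -> F a <= \sum_(y <- N | S y) F y.
Proof.
move=> aN Sa F0; rewrite big_mkcond (bigD1_seq a)//= Sa lerDl.
by apply: sumr_ge0 => y _; case: ifP => // /F0.
Qed.

Lemma cut_term_le (N : {fset V}) (S : pred V) (F : V -> V -> R) a b :
  a \in N -> b \in N -> S a -> ~~ S b ->
  (forall z y, S z -> ~~ S y -> 0 <= F z y) ->
  F a b <= \sum_(z <- N | S z) \sum_(y <- N | ~~ S y) F z y.
Proof.
move=> aN bN Sa Sb F0.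
have Fab : F a b <= \sum_(y <- N | ~~ S y) F a y.
  by apply: term_le_sum => // y; exact: F0.
apply: (le_trans Fab).
apply: (@term_le_sum N S (fun z => \sum_(y <- N | ~~ S y) F z y)) => // z Sz.
by apply: sumr_ge0 => y; exact: F0.
Qed.

Lemma boundary_edge (S : pred V) z0 y0 : S z0 -> ~~ S y0 ->
  exists a b, [/\ adj a b, S a & ~~ S b].
Proof.
have [p [+ <-]] := hconn z0 y0.
elim: p z0 => [z /= _ ->//|a p IH z /= /andP[za pth] Sz Sl].
case Sa: (S a); first exact: IH pth Sa Sl.
by exists z, a; rewrite Sa.
Qed.

(** On the set where f is negative the Laplacians add up to something nonnegative,
but by lap_cut this sum is the flow across the boundary of that set, all of
whose terms are nonpositive and one of which is negative.  The vertex y0 outside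
W makes this boundary nonempty. *)
Lemma min_principle c f W y0 : network c -> y0 \notin W ->
  (forall z, z \notin W -> 0 <= f z) ->
  (forall z, z \in W -> 0 <= lap c f z) -> forall z, 0 <= f z.
Proof.
move=> nc y0W f0 lf0 z; rewrite leNgt; apply/negP => fz.
have [csym cpos c0] := nc.
pose S := [pred y | f y < 0].
have SW y : S y -> y \in W.
  by move=> /= fy; apply: contraLR fy => /f0; rewrite -leNgt.
have [|a [b [ab Sa Sb]]] := @boundary_edge S z y0 fz.
  by rewrite /= -leNgt f0.
have SN y : S y -> (nb y `<=` nbhd W)%fset by move=> /SW; exact: nb_sub_nbhd.
have aN : a \in nbhd W by exact: (fsubsetP (sub_nbhd W)) (SW _ Sa).
have bN : b \in nbhd W by apply: (fsubsetP (SN _ Sa)); rewrite in_nb.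
have := lap_cut f nc SN.
have L0 : 0 <= \sum_(z <- nbhd W | S z) lap c f z.
  by apply: sumr_ge0 => y /SW; exact: lf0.
have T0 u y : S u -> ~~ S y -> c u y * (f u - f y) <= 0.
  rewrite /= -leNgt => fu fy; apply: mulr_ge0_le0; last by lra.
  by case: (boolP (adj u y)) => [/cpos/ltW//|/c0 ->].
move=> LE; move: L0; rewrite LE => L0.
have : - (c a b * (f a - f b)) <=
    - \sum_(z <- nbhd W | S z) \sum_(y <- nbhd W | ~~ S y) c z y * (f z - f y).
  rewrite -sumrN; under [leRHS]eq_bigr do rewrite -sumrN.
  apply: (cut_term_le aN bN Sa Sb (F := fun z y => - (c z y * (f z - f y)))).
  by move=> u y Su Sy; rewrite oppr_ge0; exact: T0.
have : c a b * (f a - f b) < 0.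
  by rewrite pmulr_rlt0 ?cpos//; move: Sa Sb => /=; rewrite -leNgt; lra.
by lra.
Qed.

(** The Laplacian of functions that vanish off W, as a matrix indexed by W.  The
vertex x serves only as the default value of nth. *)
Definition lapmx c W x : 'M[R]_(#|` W|) :=
  \matrix_(i < #|` W|, j < #|` W|) ((i == j)%:R * (\sum_(y <- nb (nth x W i)) c (nth x W i) y) -
                  c (nth x W i) (nth x W j)).

Definition vecfun W x (u : 'cV[R]_(#|` W|)) z : R :=
  \sum_(i < #|` W|) (nth x W i == z)%:R * u i 0.

Arguments vecfun : clear implicits.

(** The voltage for a unit current from x to the grounded complement of W.  The
explicit formula makes it a measurable function of the conductances. *)
Definition green c W x : V -> R :=
  vecfun W x (invmx (lapmx c W x) *m \col_j (nth x W j == x)%:R).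

Lemma sum_nth_delta W x (F : 'I_(#|` W|) -> R) (i : 'I_(#|` W|)) :
  \sum_(j < #|` W|) (nth x W j == nth x W i)%:R * F j = F i.
Proof.
rewrite (bigD1 i)//= eqxx mul1r big1 ?addr0// => j ji.
by rewrite nth_uniq// -(inj_eq val_inj)/= in ji *; rewrite (negbTE ji) mul0r.
Qed.

Lemma vecfun_nth W x u (i : 'I_(#|` W|)) : vecfun W x u (nth x W i) = u i 0.
Proof. exact: (@sum_nth_delta W x (fun j => u j 0)). Qed.

Lemma vecfun_out W x u z : z \notin W -> vecfun W x u z = 0.
Proof.
move=> zW; rewrite /vecfun big1// => i _; case: eqP => [wz|_]; last by rewrite mul0r.
by move: zW; rewrite -wz mem_nth.
Qed.

Lemma lap_vecfun c W x u (i : 'I_(#|` W|)) : network c ->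
  lap c (vecfun W x u) (nth x W i) = (lapmx c W x *m u) i 0.
Proof.
move=> nc; have [csym cpos c0] := nc.
have iN : (nb (nth x W i) `<=` nbhd W)%fset by rewrite nb_sub_nbhd ?mem_nth.
rewrite /lap.
under eq_bigr do rewrite mulrBr.
rewrite sumrB -mulr_suml vecfun_nth mxE.
under [RHS]eq_bigr do rewrite mxE mulrBl.
rewrite sumrB; congr (_ - _).
  under [RHS]eq_bigr do rewrite -mulrA.
  rewrite (bigD1 i)//= eqxx mul1r [X in _ + X]big1 ?addr0// => j /negbTE.
  by rewrite eq_sym => ->; rewrite mul0r.
rewrite (sum_nb iN); last by move=> y /c0 ->; rewrite mul0r.
rewrite -(big_fset_incl _ (sub_nbhd W)); last first.
  by move=> y _ yW; rewrite vecfun_out ?mulr0.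
rewrite (big_nth x) big_mkord; apply: eq_bigr => j _.
by rewrite vecfun_nth.
Qed.

(** A function in the kernel is harmonic on W and vanishes off W, so it is zero by
the minimum principle applied to it and to its opposite. *)
Lemma lapmx_unit c W x y0 : network c -> y0 \notin W -> lapmx c W x \in unitmx.
Proof.
move=> nc y0W; have [csym _ _] := nc.
have AT : (lapmx c W x)^T = lapmx c W x.
  by apply/matrixP => i j; rewrite !mxE csym eq_sym; case: eqP => [->|]//; rewrite !mul0r.
rewrite -row_free_unit; apply/inj_row_free => u.
move=> /(congr1 trmx); rewrite trmx_mul AT trmx0 => Au.
apply/rowP => i; rewrite [RHS]mxE.
have lap0 z : z \in W -> lap c (vecfun W x u^T) z = 0.
  move=> zW; have zs : (index z W < size W)%N by rewrite index_mem.
  have := lap_vecfun x u^T (Ordinal zs) nc.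
  by rewrite /= nth_index// Au mxE.
have := vecfun_nth x u^T i; rewrite mxE => <-.
apply/eqP; rewrite eq_le; apply/andP; split.
  rewrite -oppr_ge0; apply: (@min_principle c (fun z => - vecfun W x u^T z) W y0) => //.
    by move=> z zW; rewrite vecfun_out ?oppr0.
  by move=> z zW; rewrite lapN lap0 ?oppr0.
apply: (@min_principle c (vecfun W x u^T) W y0) => //.
  by move=> z zW; rewrite vecfun_out.
by move=> z zW; rewrite lap0.
Qed.

Lemma green_out c W x z : z \notin W -> green c W x z = 0.
Proof. exact: vecfun_out. Qed.

Lemma lap_green c W x y0 z : network c -> y0 \notin W -> z \in W ->
  lap c (green c W x) z = (z == x)%:R.
Proof.
move=> nc y0W zW; have zs : (index z W < size W)%N by rewrite index_mem.
have := lap_vecfun x (invmx (lapmx c W x) *m \col_j (nth x W j == x)%:R) (Ordinal zs) nc.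
rewrite mulmxA mulmxV ?(lapmx_unit _ nc y0W)// mul1mx mxE /= nth_index//.
Qed.

Lemma green_ge0 c W x y0 z : network c -> y0 \notin W -> 0 <= green c W x z.
Proof.
move=> nc y0W; apply: (@min_principle c _ W y0) => // u uW.
  by rewrite green_out.
by rewrite (lap_green _ nc y0W uW).
Qed.

Lemma green_le_diag c W x y0 z : network c -> y0 \notin W ->
  green c W x z <= green c W x x.
Proof.
move=> nc y0W; rewrite -subr_ge0.
apply: (@min_principle c (fun z => green c W x x - green c W x z) (W `\ x)%fset y0) => //.
- by apply: contra y0W => /fsetD1P[].
- move=> u; rewrite in_fsetD1 negb_and negbK => /orP[/eqP ->|uW].
    by rewrite subrr.
  by rewrite (green_out _ _ uW) subr0; exact: green_ge0 nc y0W.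
- move=> u /fsetD1P[ux uW]; rewrite lapB lap_cst.
  by rewrite (lap_green _ nc y0W uW) (negbTE ux) subr0.
Qed.

Lemma green_mono c W W' x y0 z : network c -> y0 \notin W' -> (W `<=` W')%fset ->
  green c W x z <= green c W' x z.
Proof.
move=> nc y0W' WW'; have y0W : y0 \notin W by apply: contra y0W'; exact: (fsubsetP WW').
rewrite -subr_ge0.
apply: (@min_principle c (fun z => green c W' x z - green c W x z) W y0) => // u uW.
  by rewrite (green_out _ _ uW) subr0; exact: green_ge0 nc y0W'.
rewrite lapB (lap_green _ nc y0W uW).
by rewrite (lap_green _ nc y0W' (fsubsetP WW' _ uW)) subrr.
Qed.

Lemma sum_delta_le1 (N : {fset V}) (S : pred V) x :
  \sum_(z <- N | S z) (z == x)%:R <= 1 :> R.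
Proof.
rewrite big_mkcond/= (eq_bigr (fun z => (z == x)%:R * (S x)%:R)); last first.
  by move=> z _; case: eqP => [->|_]; case: (S _); rewrite ?mulr1 ?mulr0 ?mul0r.
case: (boolP (x \in N)) => xN.
  rewrite (bigD1_seq x)//= eqxx mul1r big1 ?addr0; first by case: (S x); rewrite ?ler01.
  by move=> z /negbTE ->; rewrite mul0r.
rewrite big_seq big1 ?ler01// => z zN.
by case: eqP xN => [<-|]; rewrite ?zN// mul0r.
Qed.

(** The current through an edge from a to b with v(a) > v(b) is one of the
nonnegative terms of the flow out of the level set {v >= v(a)}, and this flow is
at most the unit current injected at x. *)
Lemma green_flow_le1 c W x y0 a b : network c -> y0 \notin W ->
  c a b * (green c W x a - green c W x b) <= 1.
Proof.
move=> nc y0W; have [csym cpos c0] := nc; set v := green c W x.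
case: (boolP (adj a b)) => [ab|/c0 ->]; last by rewrite mul0r ler01.
have [vab|vba] := leP (v a) (v b).
  apply: (@le_trans _ _ 0); last exact: ler01.
  by apply: mulr_ge0_le0; [exact/ltW/cpos|lra].
pose S := [pred z | v a <= v z].
have SW z : S z -> z \in W.
  move=> /= vz; apply: contraLR vba => zW; rewrite -leNgt (le_trans vz)//.
  by rewrite /v (green_out _ _ zW); exact: green_ge0 nc y0W.
have SN y : S y -> (nb y `<=` nbhd W)%fset by move=> /SW; exact: nb_sub_nbhd.
have Sa : S a by rewrite /=.
have aN : a \in nbhd W by exact: (fsubsetP (sub_nbhd W)) (SW _ Sa).
have bN : b \in nbhd W by apply: (fsubsetP (SN _ Sa)); rewrite in_nb.
have T0 u y : S u -> ~~ S y -> 0 <= c u y * (v u - v y).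
  rewrite /= -ltNge => vu vy; apply: mulr_ge0; last by lra.
  by case: (boolP (adj u y)) => [/cpos/ltW//|/c0 ->].
have := lap_cut v nc SN.
rewrite (eq_bigr (fun z => (z == x)%:R)); last first.
  by move=> z /SW zW; rewrite (lap_green _ nc y0W).
have := sum_delta_le1 (nbhd W) S x.
move=> S1 LE; rewrite LE in S1.
have := cut_term_le aN bN Sa _ T0; rewrite /= -ltNge => /(_ vba).
by move=> /le_trans; apply.
Qed.

Lemma green_edge_le c W x y0 a b : network c -> y0 \notin W -> adj a b ->
  green c W x a - green c W x b <= (c a b)^-1.
Proof.
move=> nc y0W ab; have [_ cpos _] := nc.
by rewrite -[_^-1]mul1r ler_pdivlMr ?cpos// mulrC; exact: green_flow_le1 nc y0W.
Qed.

Fixpoint path_resistance c x (p : seq V) : R :=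
  if p is y :: p' then (c x y)^-1 + path_resistance c y p' else 0.

Lemma green_path_le c W x y0 a p : network c -> y0 \notin W -> path adj a p ->
  green c W x a - green c W x (last a p) <= path_resistance c a p.
Proof.
move=> nc y0W; elim: p a => [a _ /=|b p IH a /= /andP[ab /IH]]; first by rewrite subrr.
by have := green_edge_le x nc y0W ab; lra.
Qed.

Definition dirichlet c N f k : R :=
  \sum_(a <- N) \sum_(b <- N) c a b * (f a - f b) * (k a - k b).

(** Summation by parts; the factor 2 comes from the two orientations of an edge. *)
Lemma dirichlet_lap c W f k : network c -> (forall z, z \notin W -> k z = 0) ->
  dirichlet c (nbhd W) f k = 2 * \sum_(z <- W) lap c f z * k z.
Proof.
move=> nc k0; have [csym _ _] := nc.
rewrite (big_fset_incl _ (sub_nbhd W)); last by move=> z _ /k0 ->; rewrite mulr0.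
rewrite (eq_bigr (fun z => \sum_(y <- nbhd W) c z y * (f z - f y) * k z)); last first.
  move=> z _; case: (boolP (z \in W)) => zW.
    by rewrite (lapE _ nc (nb_sub_nbhd zW)) mulr_suml.
  by rewrite k0// mulr0 big1// => y _; rewrite mulr0.
set T := (X in 2 * X).
have TE : T = - \sum_(z <- nbhd W) \sum_(y <- nbhd W) c z y * (f z - f y) * k y.
  rewrite /T exchange_big/= -sumrN; apply: eq_bigr => z _; rewrite -sumrN.
  by apply: eq_bigr => y _; rewrite csym; ring.
rewrite mulr_natl mulr2n {2}TE -sumrB; apply: eq_bigr => z _; rewrite -sumrB.
by apply: eq_bigr => y _; ring.
Qed.

Lemma sum_lap_green c W x y0 k : network c -> y0 \notin W -> x \in W ->
  \sum_(z <- W) lap c (green c W x) z * k z = k x.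
Proof.
move=> nc y0W xW; rewrite (bigD1_seq x)//= (lap_green _ nc y0W xW) eqxx mul1r.
rewrite big_seq_cond big1 ?addr0// => z /andP[zW /negbTE zx].
by rewrite (lap_green _ nc y0W zW) zx mul0r.
Qed.

Lemma dirichletC c N f k : dirichlet c N f k = dirichlet c N k f.
Proof.
by apply: eq_bigr => a _; apply: eq_bigr => b _; rewrite -!mulrA [X in _ * X]mulrC.
Qed.

(** Reciprocity: both sides are half the mutual energy of the two voltages. *)
Lemma green_sym c W x y y0 : network c -> y0 \notin W -> x \in W -> y \in W ->
  green c W x y = green c W y x.
Proof.
move=> nc y0W xW yW.
have := dirichletC c (nbhd W) (green c W x) (green c W y).
rewrite !dirichlet_lap//; try by move=> ? ?; rewrite green_out.
by rewrite !(sum_lap_green _ nc y0W)//; lra.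
Qed.

(** Every edge near W counts twice here, once for each orientation. *)
Definition resistance_dist W c c' : R :=
  \sum_(a <- nbhd W) \sum_(b <- nbhd W | adj a b) `|(c a b)^-1 - (c' a b)^-1|.

(** With v the c-voltage from x and w the c'-voltage from y, the two energies of
the pair (v, w) are 2 w(x) = 2 v'(y) for c, where v' is the c'-voltage from x,
and 2 v(y) for c'.  Their difference is a sum over the edges of the change of
resistance times the product of the unit flows of v and w. *)
Lemma green_stable c c' W x y y0 : network c -> network c' ->
  y0 \notin W -> x \in W ->
  `|green c W x y - green c' W x y| <= resistance_dist W c c'.
Proof.
move=> nc nc' y0W xW.
have rd0 : 0 <= resistance_dist W c c' by apply: sumr_ge0 => a _; apply: sumr_ge0.
case: (boolP (y \in W)) => yW; last by rewrite !green_out// subrr normr0.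
set v := green c W x; set w := green c' W y.
have E1 : dirichlet c (nbhd W) v w = 2 * w x.
  by rewrite dirichlet_lap ?(sum_lap_green _ nc y0W)// => z zW; rewrite /w green_out.
have E2 : dirichlet c' (nbhd W) v w = 2 * v y.
  rewrite dirichletC dirichlet_lap ?(sum_lap_green _ nc' y0W)// => z zW.
  by rewrite /v green_out.
have -> : green c' W x y = w x by rewrite (green_sym nc' y0W).
have -> : v y - w x = 2^-1 * (dirichlet c' (nbhd W) v w - dirichlet c (nbhd W) v w).
  by rewrite E1 E2; field.
have : `|dirichlet c' (nbhd W) v w - dirichlet c (nbhd W) v w| <= resistance_dist W c c'.
  rewrite -sumrB; apply: (le_trans (ler_norm_sum _ _ _)).
  apply: ler_sum => a _; rewrite -sumrB; apply: (le_trans (ler_norm_sum _ _ _)).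
  rewrite [leRHS]big_mkcond/=; apply: ler_sum => b _.
  have [csym cpos c0] := nc; have [csym' cpos' c0'] := nc'.
  case: ifPn => [ab|nab]; last by rewrite c0// c0'// !mul0r subrr normr0.
  have cp := cpos _ _ ab; have cp' := cpos' _ _ ab.
  (* change of resistance times the two flows, both at most 1 in absolute value *)
  have -> : c' a b * (v a - v b) * (w a - w b) - c a b * (v a - v b) * (w a - w b) =
      ((c a b)^-1 - (c' a b)^-1) * ((c a b * (v a - v b)) * (c' a b * (w a - w b))).
    by field; rewrite !gt_eqF.
  rewrite normrM ler_piMr// normrM mulr_ile1//.
    rewrite ler_norml (green_flow_le1 _ _ _ nc y0W) andbT.
    by have := green_flow_le1 x b a nc y0W; rewrite csym -/v; lra.
  rewrite ler_norml (green_flow_le1 _ _ _ nc' y0W) andbT.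
  by have := green_flow_le1 y b a nc' y0W; rewrite csym' -/w; lra.
rewrite normrM gtr0_norm ?invr_gt0//.
move: rd0; lra.
Qed.

End Potential.

(** * Integrals over a sub-sigma-algebra *)

Import HBNNSimple.

Section SubSigmaAlgebra.
Variables (R : realType) (d : measure_display) (Omega : measurableType d).
Variables (P : probability Omega R) (G : set (set Omega)).
Hypotheses (sG : sigma_algebra setT G) (GM : G `<=` measurable).

Definition measurable_wrt (f : Omega -> R) : Prop :=
  measurable_fun setT (f : g_sigma_algebraType G -> R).

Lemma measurable_generatedE : (measurable : set (set (g_sigma_algebraType G))) = G.
Proof. exact: measurable_g_measurableTypeE. Qed.

Lemma measurable_wrt_measurable f : measurable_wrt f -> measurable_fun setT f.
Proof. by move=> mf mT B mB; apply: GM; rewrite -measurable_generatedE; apply: mf. Qed.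

Lemma measurable_wrt_indic A : G A -> measurable_wrt \1_A.
Proof. by move=> GA; apply: measurable_indic; rewrite measurable_generatedE. Qed.

(** Extends the defining property of a conditional probability from events to
nonnegative functions: approximation of f by simple functions that are
measurable for G, and monotone convergence. *)
Lemma eq_integral_sub (p q : Omega -> R) :
  measurable_fun setT p -> measurable_fun setT q ->
  (forall w, 0 <= p w) -> (forall w, 0 <= q w) ->
  (forall A, G A -> (\int[P]_(w in A) (p w)%:E = \int[P]_(w in A) (q w)%:E)%E) ->
  forall f, measurable_wrt f -> (forall w, 0 <= f w) ->
  (\int[P]_w (f w * p w)%:E = \int[P]_w (f w * q w)%:E)%E.
Proof.
move=> mp mq p0 q0 pq f mf f0.
have mF : measurable_fun setT (EFin \o f : g_sigma_algebraType G -> \bar R).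
  exact/measurable_EFinP.
pose g := nnsfun_approx (@measurableT _ (g_sigma_algebraType G)) mF.
have gcvg (w : Omega) : (g n w)%:E @[n --> \oo] --> (f w)%:E.
  by apply: (cvg_nnsfun_approx _ mF) => // x _; rewrite lee_fin f0.
have gnd (w : Omega) m n : (m <= n)%N -> g m w <= g n w.
  move=> mn; have /lefP := nd_nnsfun_approx (@measurableT _ (g_sigma_algebraType G)) mF mn.
  exact.
have gm n : measurable_fun setT (g n : Omega -> R).
  by apply: measurable_wrt_measurable; exact: (measurable_funPT (g n)).
have key (h : Omega -> R) : measurable_fun setT h -> (forall w, 0 <= h w) ->
    (\int[P]_w (f w * h w)%:E = limn (fun n => \int[P]_w (g n w * h w)%:E))%E.
  move=> mh h0; rewrite -monotone_convergence//.
  - apply: eq_integral => w _; apply/esym/cvg_lim => //.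
    under eq_fun do rewrite EFinM.
    by rewrite EFinM; apply: cvgeZr => //.
  - by move=> n; apply/measurable_EFinP; exact: measurable_funM.
  - by move=> n w _; rewrite lee_fin mulr_ge0.
  - by move=> w _ m n mn; rewrite lee_fin ler_wpM2r// gnd.
rewrite !key//; congr (limn _); apply/funext => n.
pose A r : set Omega := g n @^-1` [set r].
have mA r : measurable (A r) by rewrite -[X in measurable X]setTI; exact: gm.
have key2 (h : Omega -> R) : measurable_fun setT h -> (forall w, 0 <= h w) ->
    (\int[P]_w (g n w * h w)%:E =
     \sum_(r <- fset_set (range (g n))) (r%:E * \int[P]_(w in A r) (h w)%:E))%E.
  move=> mh h0.
  transitivity (\int[P]_w (\sum_(r <- fset_set (range (g n)))
      (r * (\1_(A r) w * h w))%:E))%E.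
    apply: eq_integral => w _; rewrite {1}(fimfunE (g n) w) fsbig_finite//= sumEFin.
    by congr EFin; rewrite mulr_suml; apply: eq_bigr => r _; rewrite mulrA.
  have mi r : measurable_fun setT (fun w => \1_(A r) w * h w).
    by apply: measurable_funM => //; apply: measurable_indic.
  have i0 r w : 0 <= r * (\1_(A r) w * h w).
    rewrite mulrA mulr_ge0// indicE; case: (boolP (_ \in _)); last by rewrite mulr0.
    by rewrite inE/= mulr1 => <-.
  have mri r : measurable_fun setT (fun w => (r * (\1_(A r) w * h w))%:E).
    by apply/measurable_EFinP; apply: measurable_funM.
  rewrite (ge0_integral_sum _ _ mri)//; last first.
    by move=> r w _; rewrite lee_fin; exact: i0.
  apply: eq_bigr => r _.
  have [r0|r0] := leP 0 r; last first.
    have e0 : A r = set0.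
      by apply/seteqP; split => // w /= rw; move: r0; rewrite -rw ltNge fun_ge0.
    rewrite e0 integral_set0 mule0 integral0_eq// => w _.
    by rewrite indic0 mul0r mulr0.
  under eq_integral do rewrite EFinM.
  rewrite ge0_integralZl//.
  - congr (_ * _)%E; rewrite [RHS]integral_mkcond.
    by apply: eq_integral => w _; rewrite epatch_indic/= -EFinM mulrC.
  - exact/measurable_EFinP.
  - by move=> w _; rewrite lee_fin mulr_ge0.
rewrite !key2//; apply: eq_bigr => r _; rewrite pq//.
by rewrite -measurable_generatedE; exact: (measurable_funPTI (g n)).
Qed.

End SubSigmaAlgebra.

(** * One step of the walk and the voltage *)

Section Conductance.
Variables (V : choiceType) (adj : rel V) (R : realType).
Hypotheses (hsimple : simple_graph adj) (hfin : locally_finite adj)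
  (hconn : connected_graph adj).
Implicit Types (C : {fset V} -> R) (c : V -> V -> R) (W : {fset V}).

Definition conductance C a b : R := if adj a b then C [fset a; b]%fset else 0.

Lemma edge_of a b : adj a b -> edges adj [fset a; b]%fset.
Proof. by move=> ab; exists a, b. Qed.

Lemma network_conductance C : (forall e, edges adj e -> 0 < C e) -> network adj (conductance C).
Proof.
move=> C0; split=> [a b|a b ab|a b /negbTE ab]; rewrite /conductance ?ab//.
  by have [s _] := hsimple; rewrite s fsetUC.
by apply: C0; exact: edge_of.
Qed.

Definition wdeg c z : R := \sum_(y <- nb adj z) c z y.

Lemma trans_probE C z y : trans_prob adj C z y = conductance C z y / wdeg (conductance C) z.
Proof.
rewrite /trans_prob /conductance; case: ifP => zy; last by rewrite mul0r.
congr (_ / _); rewrite fsbig_finite//.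
rewrite /wdeg; apply: eq_big_seq => u; rewrite (in_nb hfin) => -> //.
Qed.

Lemma network_ge0 c a b : network adj c -> 0 <= c a b.
Proof.
by move=> [_ cpos c0]; case: (boolP (adj a b)) => [/cpos/ltW//|/c0 ->].
Qed.

Lemma wdeg_ge0 c z : network adj c -> 0 <= wdeg c z.
Proof. by move=> nc; apply: sumr_ge0 => y _; exact: network_ge0. Qed.

Lemma trans_prob_ge0 C z y : (forall e, edges adj e -> 0 < C e) ->
  0 <= trans_prob adj C z y.
Proof.
move=> /network_conductance nc.
by rewrite trans_probE divr_ge0 ?wdeg_ge0 ?network_ge0.
Qed.

Lemma wdeg_gt0 c z y0 : network adj c -> y0 != z -> 0 < wdeg c z.
Proof.
move=> nc y0z; have [_ cpos c0] := nc.
have [|a [b [ab /eqP az _]]] := @boundary_edge V adj hconn (pred1 z) z y0 _ y0z.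
  by rewrite /= eqxx.
subst a; apply: (lt_le_trans (cpos _ _ ab)).
apply: (@term_le_sum V R (nb adj z) predT (c z)) => //; first by rewrite in_nb.
by move=> y _; exact: network_ge0.
Qed.

(** The mean of the voltage after a step from z is v(z) minus the Laplacian of v at
z over the total conductance at z. *)
Lemma green_drift c W x y0 z : network adj c -> y0 \notin W -> z \in W ->
  \sum_(y <- W) green adj c W x y * (c z y / wdeg c z) + (z == x)%:R / wdeg c z =
  green adj c W x z.
Proof.
move=> nc y0W zW.
have dz : wdeg c z != 0.
  by rewrite gt_eqF// (@wdeg_gt0 c z y0)//; apply: contraNneq y0W => ->.
have := lap_green hfin hconn x nc y0W zW; rewrite /lap.
under eq_bigr do rewrite mulrBr.
rewrite sumrB -mulr_suml -/(wdeg c z) => E.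
have -> : \sum_(y <- W) green adj c W x y * (c z y / wdeg c z) =
    (\sum_(y <- nb adj z) c z y * green adj c W x y) / wdeg c z.
  rewrite (sum_nb hfin (nb_sub_nbhd adj zW)); last first.
    by have [_ _ c0] := nc; move=> y /c0 ->; rewrite mul0r.
  rewrite -(big_fset_incl _ (sub_nbhd adj W)); last first.
    by move=> y _ yW; rewrite green_out// mulr0.
  by rewrite mulr_suml; apply: eq_bigr => y _; ring.
by rewrite -E; field.
Qed.

End Conductance.

(** * Measurability of the voltage in the conductances *)

Section MeasurableGreen.
Variables (R : realType) (d : measure_display) (T : measurableType d).

Lemma measurable_inv (f : T -> R) : measurable_fun setT f ->
  (forall w, f w != 0) -> measurable_fun setT (fun w => (f w)^-1).
Proof.
move=> mf f0.
(* the square makes the base of the real power nonnegative *)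
rewrite (_ : (fun w => _) = (fun w => f w * ((f w ^+ 2) `^ (-1)))); last first.
  apply/funext => w; rewrite powR_inv1 ?sqr_ge0// expr2 invfM mulrA divff ?mul1r//.
apply: measurable_funM => //.
by apply: (measurableT_comp (measurable_powR _)) => //; exact: measurable_funX.
Qed.

Lemma measurable_det n (A : T -> 'M[R]_n) :
  (forall i j, measurable_fun setT (fun w => A w i j)) ->
  measurable_fun setT (fun w => \det (A w)).
Proof.
move=> mA; apply: measurable_sum => s.
by apply: measurable_funM => //; apply: measurable_prod => i _.
Qed.

Lemma measurable_invmx n (A : T -> 'M[R]_n) i j :
  (forall i j, measurable_fun setT (fun w => A w i j)) ->
  (forall w, A w \in unitmx) ->
  measurable_fun setT (fun w => invmx (A w) i j).
Proof.
move=> mA uA.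
rewrite (_ : (fun w => _) = (fun w => (\det (A w))^-1 *
    ((-1) ^+ (j + i) * \det (row' j (col' i (A w)))))); last first.
  by apply/funext => w; rewrite /invmx uA !mxE.
apply: measurable_funM.
  by apply: measurable_inv; [exact: measurable_det|move=> w; rewrite -unitfE -unitmxE].
apply: measurable_funM => //; apply: measurable_det => k l.
rewrite (_ : (fun w => _) = (fun w => A w (lift j k) (lift i l)))//.
by apply/funext => w; rewrite !mxE.
Qed.

Variables (V : choiceType) (adj : rel V).
Hypotheses (hsimple : simple_graph adj) (hfin : locally_finite adj)
  (hconn : connected_graph adj).
Variables (C : T -> {fset V} -> R).
Hypotheses (mC : forall e, edges adj e -> measurable_fun setT (fun w => C w e)).
Hypotheses (C0 : forall w e, edges adj e -> 0 < C w e).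

Lemma measurable_conductance a b : measurable_fun setT (fun w => conductance adj (C w) a b).
Proof.
rewrite /conductance; case: (boolP (adj a b)) => ab; last exact: measurable_cst.
by apply: mC; exact: edge_of.
Qed.

Lemma measurable_wdeg z : measurable_fun setT (fun w => wdeg adj (conductance adj (C w)) z).
Proof. by rewrite /wdeg; apply: measurable_sum => y; exact: measurable_conductance. Qed.

(** In a graph with a single vertex the total conductance is zero. *)
Lemma measurable_inv_wdeg z :
  measurable_fun setT (fun w => (wdeg adj (conductance adj (C w)) z)^-1).
Proof.
have [[y0 y0z]|nex] := pselect (exists y0, y0 != z).
  apply: measurable_inv => [|w]; first exact: measurable_wdeg.
  by rewrite gt_eqF// (wdeg_gt0 hfin hconn _ y0z)//; apply: network_conductance => //; exact: C0.
rewrite (_ : (fun w => _) = cst 0); first exact: measurable_cst.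
apply/funext => w; rewrite /wdeg big_seq big1 ?invr0// => y.
rewrite (in_nb hfin) => zy; exfalso; apply: nex; exists y; apply/eqP => yz.
by move: zy; rewrite yz; have [_ ->] := hsimple.
Qed.

Lemma measurable_green W x y0 z : y0 \notin W ->
  measurable_fun setT (fun w => green adj (conductance adj (C w)) W x z).
Proof.
move=> y0W; apply: measurable_sum => i; apply: measurable_funM => //.
rewrite (_ : (fun w => _) = (fun w => \sum_(j < #|` W|)
    invmx (lapmx adj (conductance adj (C w)) W x) i j * (nth x W j == x)%:R)); last first.
  by apply/funext => w; rewrite mxE; apply: eq_bigr => j _; rewrite mxE.
apply: measurable_sum => j; apply: measurable_funM => //.
apply: measurable_invmx => [k l|w]; last first.
  by apply: lapmx_unit y0W => //; apply: network_conductance => //; exact: C0.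
rewrite (_ : (fun w => _) = (fun w => (k == l)%:R * wdeg adj (conductance adj (C w)) (nth x W k) -
    conductance adj (C w) (nth x W k) (nth x W l))); last first.
  by apply/funext => w; rewrite mxE.
apply: measurable_funB; last exact: measurable_conductance.
by apply: measurable_funM => //; exact: measurable_wdeg.
Qed.

Lemma measurable_inv_conductance a b : adj a b ->
  measurable_fun setT (fun w => (conductance adj (C w) a b)^-1).
Proof.
move=> ab; apply: measurable_inv => [|w]; first exact: measurable_conductance.
by rewrite /conductance ab gt_eqF// C0//; exact: edge_of.
Qed.

End MeasurableGreen.

(** * Walks adapted to a filtration *)

(** The filtration is left free, so that the notion is stable under shifts of
time and also covers a Markov chain with its own filtration. *)
Record adapted_walk (R : realType) (d : measure_display) (Omega : measurableType d)
    (P : probability Omega R) (V : choiceType) (adj : rel V)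
    (F : nat -> set (set Omega)) (X : nat -> Omega -> V)
    (C : nat -> Omega -> {fset V} -> R) : Prop := AdaptedWalk {
  aw_sigma : forall t, sigma_algebra setT (F t);
  aw_sub : forall t, F t `<=` measurable;
  aw_mono : forall t, F t `<=` F t.+1;
  aw_X : forall t (U : set V), F t (X t @^-1` U);
  aw_C : forall t e, edges adj e -> forall B : set R, measurable B ->
    F t ((fun w => C t w e) @^-1` B);
  aw_pos : forall t w e, edges adj e -> 0 < C t w e;
  aw_step : forall t y, is_cond_prob P (F t) [set w | X t.+1 w = y]
    (fun w => trans_prob adj (C t w) (X t w) y) }.

Section Walk.
Variables (R : realType) (d : measure_display) (Omega : measurableType d).
Variables (P : probability Omega R) (V : choiceType) (adj : rel V).
Hypotheses (hsimple : simple_graph adj) (hfin : locally_finite adj)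
  (hconn : connected_graph adj).
Variables (F : nat -> set (set Omega)) (X : nat -> Omega -> V)
  (C : nat -> Omega -> {fset V} -> R).
Hypothesis aw : adapted_walk P adj F X C.

Local Notation c t w := (conductance adj (C t w)).
Local Notation g W x t w := (green adj (c t w) W x).

Local Notation Fm t := (@measurable_wrt R d Omega (F t)).

Lemma network_walk t w : network adj (c t w).
Proof. by apply: network_conductance => // e; exact: (aw_pos aw). Qed.

Let sF t := aw_sigma aw t.

Lemma F_measurable t (A : set Omega) :
  measurable (A : set (g_sigma_algebraType (F t))) -> F t A.
Proof. by rewrite measurable_generatedE. Qed.

Lemma measurable_F t A : F t A -> measurable (A : set (g_sigma_algebraType (F t))).
Proof. by rewrite measurable_generatedE. Qed.

Lemma measurable_wrt_mono t f : Fm t f -> Fm t.+1 f.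
Proof.
move=> mf mT B mB; rewrite measurable_generatedE//; apply: (aw_mono aw).
by rewrite -(measurable_generatedE (sF t)); apply: mf.
Qed.

Lemma measurable_wrtM t f h : Fm t f -> Fm t h -> Fm t (fun w => f w * h w).
Proof. exact: measurable_funM. Qed.

Lemma measurable_wrtD t f h : Fm t f -> Fm t h -> Fm t (fun w => f w + h w).
Proof. exact: measurable_funD. Qed.

Lemma measurable_wrtB t f h : Fm t f -> Fm t h -> Fm t (fun w => f w - h w).
Proof. exact: measurable_funB. Qed.

Lemma measurable_wrt_cst t r : Fm t (fun=> r).
Proof. exact: measurable_cst. Qed.

Lemma measurable_wrt_sum t (I : Type) (s : seq I) (h : I -> Omega -> R) :
  (forall i, Fm t (h i)) -> Fm t (fun w => \sum_(i <- s) h i w).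
Proof. exact: measurable_sum. Qed.

Lemma measurable_wrt_leP t f h : Fm t f -> Fm t h -> F t [set w | f w <= h w].
Proof.
move=> mf mh; apply: F_measurable.
have := measurable_fun_ler mf mh => /(_ measurableT [set true]).
by rewrite setTI; apply.
Qed.

Lemma F_setI t A B : F t A -> F t B -> F t (A `&` B).
Proof.
by move=> FA FB; apply: F_measurable; apply: measurableI; exact: measurable_F.
Qed.

Lemma F_bigcap t (A : nat -> set Omega) : (forall n, F t (A n)) -> F t (\bigcap_n A n).
Proof.
move=> FA; apply: F_measurable; apply: bigcap_measurable.
by exists 0%N. by move=> k _; exact: measurable_F.
Qed.

Lemma F_monoL s t : (s <= t)%N -> F s `<=` F t.
Proof.
move=> /subnK <-; elim: (t - s)%N => [//|k IH].
by rewrite addSn; apply: subset_trans IH _; exact: (aw_mono aw).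
Qed.

Lemma measurable_wrt_X t y : Fm t (fun w => (X t w == y)%:R).
Proof.
rewrite (_ : (fun w => _) = \1_(X t @^-1` [set y])).
  by apply: measurable_wrt_indic => //; exact: (aw_X aw).
apply/funext => w; rewrite indicE; congr (nat_of_bool _)%:R.
by apply/eqP/idP; rewrite in_setE.
Qed.

Lemma measurable_wrt_C t e : edges adj e -> Fm t (fun w => C t w e).
Proof. by move=> he mT B mB; rewrite setTI measurable_generatedE//; exact: (aw_C aw). Qed.

Lemma measurable_wrt_green t W x y0 y : y0 \notin W -> Fm t (fun w => g W x t w y).
Proof.
move=> y0W; apply: (measurable_green hsimple hfin hconn _ _ x y y0W).
  exact: measurable_wrt_C.
by move=> w e; exact: (aw_pos aw).
Qed.

Lemma measurable_wrt_inv_wdeg t z : Fm t (fun w => (wdeg adj (c t w) z)^-1).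
Proof.
apply: measurable_inv_wdeg => //; first exact: measurable_wrt_C.
by move=> w e; exact: (aw_pos aw).
Qed.

Lemma measurable_wrt_inv_conductance t a b : adj a b -> Fm t (fun w => (c t w a b)^-1).
Proof.
move=> ab; apply: measurable_inv_conductance => //; first exact: measurable_wrt_C.
by move=> w e; exact: (aw_pos aw).
Qed.

(** Turns the voltage at a random position into a finite sum of voltages at fixed
vertices, to which measurability and conditioning apply. *)
Lemma sum_at (W : {fset V}) (f : V -> R) z : (forall y, y \notin W -> f y = 0) ->
  f z = \sum_(y <- W) f y * (z == y)%:R.
Proof.
move=> f0; case: (boolP (z \in W)) => zW.
  rewrite (bigD1_seq z)//= eqxx mulr1 big1 ?addr0// => y /negbTE.
  by rewrite eq_sym => ->; rewrite mulr0.
rewrite f0// big_seq big1// => y yW; case: eqP => [zy|_]; last by rewrite mulr0.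
by move: zW; rewrite zy yW.
Qed.

Lemma measurable_wrt_green_X s t W x y0 : (s <= t)%N -> y0 \notin W ->
  Fm t (fun w => g W x s w (X t w)).
Proof.
move=> st y0W.
rewrite (_ : (fun w => _) = (fun w => \sum_(y <- W) g W x s w y * (X t w == y)%:R)).
  apply: measurable_wrt_sum => y; apply: measurable_wrtM; last exact: measurable_wrt_X.
  have := @measurable_wrt_green s W x y0 y y0W; move: st => /subnK <-.
  by elim: (t - s)%N => [//|k IH] /IH; exact: measurable_wrt_mono.
by apply/funext => w; apply: sum_at => y; exact: green_out.
Qed.

Lemma step_integral t y (f : Omega -> R) : Fm t f -> (forall w, 0 <= f w) ->
  (\int[P]_w (f w * trans_prob adj (C t w) (X t w) y)%:E =
   \int[P]_w (f w * (X t.+1 w == y)%:R)%:E)%E.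
Proof.
move=> mf f0; have [mp Ep] := aw_step aw t y.
have XE : (fun w => (X t.+1 w == y)%:R) = \1_[set w | X t.+1 w = y] :> (Omega -> R).
  apply/funext => w; rewrite indicE; congr (nat_of_bool _)%:R.
  by apply/eqP/idP; rewrite in_setE.
have mX : measurable [set w | X t.+1 w = y].
  by apply: (aw_sub aw (t := t.+1)); exact: (aw_X aw _ [set y]).
have mq : measurable_fun setT (fun w => (X t.+1 w == y)%:R : R).
  by rewrite XE; exact: measurable_indic.
apply: (eq_integral_sub (sF t) (@aw_sub _ _ _ _ _ _ _ _ _ aw t)) => //.
- by move=> mT B mB; rewrite setTI; apply: (aw_sub aw (t := t)); exact: mp.
- by move=> w; apply: trans_prob_ge0 => // e; exact: (aw_pos aw).
- move=> A FA; rewrite Ep// setIC -integral_indic//; last exact: (aw_sub aw FA).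
  by apply: eq_integral => w _; rewrite -XE.
Qed.

(** Only steps into W contribute to the mean of the voltage after the step, because
the voltage vanishes off W; so step_integral is used finitely many times, and
the sum of the results is computed by green_drift.  All the integrands are
nonnegative, so no integrability is needed. *)
Lemma drift t W x y0 (f : Omega -> R) : y0 \notin W -> Fm t f ->
  (forall w, 0 <= f w) -> (forall w, X t w \notin W -> f w = 0) ->
  (\int[P]_w (f w * g W x t w (X t w))%:E =
   \int[P]_w (f w * g W x t w (X t.+1 w))%:E +
   \int[P]_w (f w * ((X t w == x)%:R / wdeg adj (c t w) x))%:E)%E.
Proof.
move=> y0W mf f0 fW.
have g0 w y : 0 <= g W x t w y by apply: green_ge0 y0W => //; exact: network_walk.
have d0 w z : 0 <= (wdeg adj (c t w) z)^-1.
  by rewrite invr_ge0; apply: wdeg_ge0; exact: network_walk.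
have p0 w y : 0 <= trans_prob adj (C t w) (X t w) y.
  by apply: trans_prob_ge0 => // e; exact: (aw_pos aw).
have mp y : measurable_fun setT (fun w => trans_prob adj (C t w) (X t w) y).
  move=> mT B mB; rewrite setTI; apply: (aw_sub aw (t := t)).
  by have [mp _] := aw_step aw t y; exact: mp.
have mfO (h : Omega -> R) u : Fm u h -> measurable_fun setT h.
  by apply: measurable_wrt_measurable => //; exact: (aw_sub aw (t := u)).
have mfg y : Fm t (fun w => f w * g W x t w y).
  by apply: measurable_wrtM => //; exact: measurable_wrt_green y0W.
have -> : (\int[P]_w (f w * g W x t w (X t.+1 w))%:E =
    \int[P]_w (\sum_(y <- W) (f w * g W x t w y * trans_prob adj (C t w) (X t w) y)%:E))%E.
  rewrite ge0_integral_sum//; last 2 first.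
  - by move=> y; apply/measurable_EFinP; apply: measurable_funM; [exact: mfO (mfg y)|exact: mp].
  - by move=> y w _; rewrite lee_fin !mulr_ge0.
  rewrite (eq_bigr (fun y => \int[P]_w (f w * g W x t w y * (X t.+1 w == y)%:R)%:E)%E); last first.
    by move=> y _; apply: step_integral => // w; rewrite mulr_ge0.
  rewrite -ge0_integral_sum//; last 2 first.
  - move=> y; apply/measurable_EFinP; apply: measurable_funM; first exact: mfO (mfg y).
    exact: mfO (@measurable_wrt_X t.+1 y).
  - by move=> y w _; rewrite lee_fin !mulr_ge0.
  apply: eq_integral => w _; rewrite sumEFin; congr EFin.
  rewrite (@sum_at W (g W x t w)); last by move=> y; exact: green_out.
  by rewrite mulr_sumr; apply: eq_bigr => y _; rewrite mulrA.
rewrite -ge0_integralD//.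
- apply: eq_integral => w _; rewrite sumEFin -EFinD; congr EFin.
  case: (boolP (X t w \in W)) => XW; last first.
    by rewrite fW// !mul0r addr0 big1// => y _; rewrite !mul0r.
  rewrite -[in LHS](green_drift hfin hconn x (network_walk t w) y0W XW) mulrDr.
  congr (_ + _).
    by rewrite mulr_sumr; apply: eq_bigr => y _; rewrite trans_probE// mulrA.
  by case: eqP => [->//|_]; rewrite !mul0r.
- by move=> w _; apply: sume_ge0 => y _; rewrite lee_fin !mulr_ge0.
- apply: emeasurable_sum => y; apply/measurable_EFinP; apply: measurable_funM => //.
  exact: mfO (mfg y).
- by move=> w _; rewrite lee_fin !mulr_ge0.
- apply/measurable_EFinP; apply: (mfO _ t); apply: measurable_wrtM => //.
  by apply: measurable_wrtM; [exact: measurable_wrt_X|exact: measurable_wrt_inv_wdeg].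
Qed.

End Walk.

Lemma addeI_fin (R : realType) (a x y : \bar R) : a \is a fin_num ->
  (a + x = a + y)%E -> x = y.
Proof.
by move=> fa axy; rewrite -(addeK x fa) -(addeK y fa) (addeC x) (addeC y) axy.
Qed.

(** * The two supermartingale estimates *)

Section Supermartingales.
Variables (R : realType) (d : measure_display) (Omega : measurableType d).
Variables (P : probability Omega R) (V : choiceType) (adj : rel V).
Hypotheses (hsimple : simple_graph adj) (hfin : locally_finite adj)
  (hconn : connected_graph adj).
Variables (F : nat -> set (set Omega)) (X : nat -> Omega -> V)
  (C : nat -> Omega -> {fset V} -> R).

Local Notation c t w := (conductance adj (C t w)).
Local Notation g W x t w := (green adj (c t w) W x).

(** Twice the part of Gamma that is used near W before time t. *)
Definition local_variation (W : {fset V}) t w : R :=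
  \sum_(r < t) resistance_dist adj W (c r w) (c r.+1 w).

(** The event that localizes the estimates at time t: the position and the bounds
recorded in A have been good so far. *)
Definition alive (A : nat -> set Omega) (S : set V) t : set Omega :=
  [set w | forall r, (r <= t)%N -> A r w /\ S (X r w)].

(** A visit to x weighted by the inverse conductance: what the voltage loses in
mean at such a visit. *)
Definition alive_visit (A : nat -> set Omega) (W : {fset V}) x t w : R :=
  \1_(alive A [set` W] t) w * ((X t w == x)%:R / wdeg adj (c t w) x).

Lemma alive_cur A S t w : alive A S t w -> A t w /\ S (X t w).
Proof. by apply. Qed.

Lemma alive_mono A S s t : (s <= t)%N -> alive A S t `<=` alive A S s.
Proof. by move=> st w Bw r rs; apply: Bw; exact: leq_trans rs st. Qed.

Lemma alive_succ A S t : alive A S t.+1 = alive A S t `&` (A t.+1 `&` X t.+1 @^-1` S).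
Proof.
apply/seteqP; split => [w Bw|w [Bw [Aw Sw]] r].
  by split; [exact: alive_mono Bw|exact: alive_cur Bw].
by rewrite leq_eqVlt => /orP[/eqP ->//|]; rewrite ltnS; exact: Bw.
Qed.

Hypothesis aw : adapted_walk P adj F X C.

Local Notation Fm t := (@measurable_wrt R d Omega (F t)).
Local Notation nw := (@network_walk R d Omega P V adj hsimple F X C aw).

Lemma local_variation_ge0 W t w : 0 <= local_variation W t w.
Proof. by do 3 apply: sumr_ge0 => ? _. Qed.

Lemma local_variationS W t w :
  local_variation W t.+1 w = local_variation W t w + resistance_dist adj W (c t w) (c t.+1 w).
Proof. by rewrite /local_variation big_ord_recr. Qed.

Lemma green_local_variation W x y0 t w y : y0 \notin W -> x \in W ->
  `|g W x t w y - g W x 0%N w y| <= local_variation W t w.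
Proof.
move=> y0W xW; elim: t => [|t IH]; first by rewrite subrr normr0 local_variation_ge0.
have := green_stable hfin hconn y (nw t w) (nw t.+1 w) y0W xW; move: IH.
rewrite local_variationS !ler_norml => /andP[? ?] /andP[? ?].
by apply/andP; split; lra.
Qed.

Lemma measurable_wrt_le s t f : (s <= t)%N -> Fm s f -> Fm t f.
Proof.
move=> /subnK <- mf; elim: (t - s)%N => [//|k IH].
by rewrite addSn; exact: (measurable_wrt_mono aw).
Qed.

Lemma measurable_wrt_local_variation W t : Fm t (local_variation W t).
Proof.
rewrite /local_variation; apply: measurable_wrt_sum => r; apply: measurable_wrt_sum => a.
rewrite /resistance_dist.
rewrite (_ : (fun w => _) = (fun w => \sum_(b <- nbhd adj W)
    (if adj a b then `|(c r w a b)^-1 - (c r.+1 w a b)^-1| else 0))); last first.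
  by apply/funext => w; rewrite big_mkcond.
apply: measurable_wrt_sum => b; case: (boolP (adj a b)) => ab; last exact: measurable_wrt_cst.
apply: measurableT_comp => //; apply: measurable_wrtB.
  by apply: (@measurable_wrt_le r); [exact: ltnW|exact: (measurable_wrt_inv_conductance aw)].
by apply: (@measurable_wrt_le r.+1); [exact: ltn_ord|exact: (measurable_wrt_inv_conductance aw)].
Qed.

Lemma F_alive A S t : (forall t, F t (A t)) -> F t (alive A S t).
Proof.
move=> FA; elim: t => [|t IH].
  rewrite (_ : alive A S 0 = A 0%N `&` X 0%N @^-1` S).
    by apply: (F_setI aw) => //; exact: (aw_X aw).
  apply/seteqP; split => [w Bw|w [Aw Sw] r]; first exact: alive_cur Bw.
  by rewrite leqn0 => /eqP ->.
rewrite alive_succ; apply: (F_setI aw); first exact: (aw_mono aw).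
by apply: (F_setI aw) => //; exact: (aw_X aw).
Qed.

Lemma measurable_wrt_alive A S t : (forall t, F t (A t)) -> Fm t \1_(alive A S t).
Proof. by move=> FA; apply: measurable_wrt_indic; [exact: (aw_sigma aw)|exact: F_alive]. Qed.

Lemma measurable_wrt_EFin t f : Fm t f -> measurable_fun setT (EFin \o f).
Proof.
move=> mf; apply/measurable_EFinP.
exact: (measurable_wrt_measurable (aw_sigma aw t) (@aw_sub _ _ _ _ _ _ _ _ _ aw t)).
Qed.

Lemma indic_ge0 (A : set Omega) w : 0 <= \1_A w :> R.
Proof. by rewrite indicE. Qed.

Lemma integral_le_cst (f : Omega -> R) a : measurable_fun setT (EFin \o f) ->
  (forall w, 0 <= f w <= a) -> (\int[P]_w (f w)%:E <= a%:E)%E.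
Proof.
move=> mf fa; apply: (@le_trans _ _ (\int[P]_w (a%:E))%E).
  by apply: ge0_le_integral => //= w _; rewrite lee_fin; case/andP: (fa w).
by rewrite integral_cst//= [P _]probability_setT mule1.
Qed.

Section Occupation.
Variables (W : {fset V}) (x y0 : V) (A : nat -> set Omega) (K L : R).
Hypotheses (xW : x \in W) (y0W : y0 \notin W) (K0 : 0 <= K) (L0 : 0 <= L).
Hypotheses (FA : forall t, F t (A t)).
Hypothesis AK : forall t w, A t w -> local_variation W t w <= K.
Hypothesis AL : forall w, A 0%N w -> g W x 0%N w x <= L.

Let B t := alive A [set` W] t.
Let pot t w := \1_(B t) w * (g W x t w (X t w) + (K - local_variation W t w)).

Let Bcur t w : B t w -> A t w /\ X t w \in W.
Proof. exact: alive_cur. Qed.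

Let g_ge0 t w y : 0 <= g W x t w y.
Proof. by apply: green_ge0 y0W => //; exact: nw. Qed.

Let pot_ge0 t w : 0 <= pot t w.
Proof.
rewrite /pot indicE; case: (boolP (_ \in _)) => [|_]; last by rewrite mul0r.
rewrite inE => /Bcur[Aw _]; rewrite mul1r addr_ge0// subr_ge0; exact: AK.
Qed.

Let mg s t : (s <= t)%N -> Fm t (fun w => g W x s w (X t w)).
Proof. by move=> st; apply: (measurable_wrt_green_X hsimple hfin hconn aw x st y0W). Qed.

Let mB t : Fm t \1_(B t). Proof. exact: measurable_wrt_alive. Qed.

Let mKb t : Fm t (fun w => K - local_variation W t w).
Proof.
by apply: measurable_wrtB; [exact: measurable_wrt_cst|exact: measurable_wrt_local_variation].
Qed.

Lemma measurable_wrt_alive_visit t : Fm t (alive_visit A W x t).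
Proof.
apply: measurable_wrtM; first exact: mB; apply: measurable_wrtM; first exact: (measurable_wrt_X aw).
exact: (measurable_wrt_inv_wdeg hsimple hfin hconn aw).
Qed.

Lemma alive_visit_ge0 t w : 0 <= alive_visit A W x t w.
Proof.
rewrite mulr_ge0 ?indic_ge0// mulr_ge0// invr_ge0.
by apply: wdeg_ge0; exact: nw.
Qed.

(* The change of the weights at time t+1 is paid by the decrease of
   K - local_variation. *)
Let pot_step t :
  (\int[P]_w (pot t.+1 w)%:E + \int[P]_w (alive_visit A W x t w)%:E <= \int[P]_w (pot t w)%:E)%E.
Proof.
have BKb w : 0 <= \1_(B t) w * (K - local_variation W t w).
  rewrite indicE; case: (boolP (_ \in _)) => [|_]; last by rewrite mul0r.
  by rewrite inE => /Bcur[Aw _]; rewrite mul1r subr_ge0; exact: AK.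
have -> : (\int[P]_w (pot t w)%:E = \int[P]_w (\1_(B t) w * g W x t w (X t w))%:E +
    \int[P]_w (\1_(B t) w * (K - local_variation W t w))%:E)%E.
  rewrite -ge0_integralD//.
  - by apply: eq_integral => w _; rewrite -EFinD -mulrDr.
  - by move=> w _; rewrite lee_fin mulr_ge0// ?indic_ge0.
  - by apply: (@measurable_wrt_EFin t); apply: measurable_wrtM => //; exact: mg.
  - by move=> w _; rewrite lee_fin.
  - by apply: (@measurable_wrt_EFin t); apply: measurable_wrtM => //; exact: mKb.
rewrite (drift hsimple hfin hconn aw x y0W (@mB t)); last 2 first.
- exact: indic_ge0.
- move=> w /negP XW; rewrite indicE; case: (boolP (_ \in _)) => //.
  by rewrite inE => /Bcur[_ /= /XW].
rewrite addeAC; apply: leeD => //.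
rewrite -ge0_integralD//.
- apply: ge0_le_integral => //.
  + by move=> w _; rewrite lee_fin.
  + apply: (@measurable_wrt_EFin t.+1); apply: measurable_wrtM; first exact: mB.
    by apply: measurable_wrtD; [exact: mg|exact: mKb].
  + apply: emeasurable_funD.
      apply: (@measurable_wrt_EFin t.+1); apply: measurable_wrtM; last exact: mg.
      by apply: (measurable_wrt_mono aw); exact: mB.
    by apply: (@measurable_wrt_EFin t); apply: measurable_wrtM => //; exact: mKb.
  + move=> w _; rewrite -EFinD lee_fin /pot [X in X * _]indicE.
    case: (boolP (_ \in _)) => [|_]; last first.
      by rewrite mul0r addr_ge0 ?BKb// mulr_ge0 ?indic_ge0//; exact: g_ge0.
    rewrite inE => Bw; have Bw' : B t w by exact: alive_mono Bw.
    rewrite indicE mem_set//= !mul1r local_variationS.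
    have := green_stable hfin hconn (X t.+1 w) (nw t w) (nw t.+1 w) y0W xW.
    by rewrite ler_norml; lra.
- by move=> w _; rewrite lee_fin mulr_ge0 ?indic_ge0//; exact: g_ge0.
- apply: (@measurable_wrt_EFin t.+1); apply: measurable_wrtM; last exact: mg.
  by apply: (measurable_wrt_mono aw); exact: mB.
- by move=> w _; rewrite lee_fin.
- by apply: (@measurable_wrt_EFin t); apply: measurable_wrtM => //; exact: mKb.
Qed.

(** Each visit costs its weight to the potential v_t(X_t) + K - variation, which
remains nonnegative while the walk is alive and starts below L + K. *)
Lemma occupation_bound T :
  (\int[P]_w (\sum_(t < T) alive_visit A W x t w)%:E <= (L + K)%:E)%E.
Proof.
have pot0 : (\int[P]_w (pot 0%N w)%:E <= (L + K)%:E)%E.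
  apply: integral_le_cst.
    apply: (@measurable_wrt_EFin 0); apply: measurable_wrtM; first exact: mB.
    by apply: measurable_wrtD; [exact: mg|exact: mKb].
  move=> w; rewrite pot_ge0/= /pot indicE; case: (boolP (_ \in _)) => [|_]; last first.
    by rewrite mul0r addr_ge0.
  rewrite inE => /Bcur[Aw _]; rewrite mul1r lerD//.
    by apply: (le_trans _ (AL Aw)); apply: (green_le_diag hfin hconn x _ _ y0W) => //; exact: nw.
  by rewrite lerBlDr lerDl local_variation_ge0.
have : (\sum_(t < T) \int[P]_w (alive_visit A W x t w)%:E + \int[P]_w (pot T w)%:E <= (L + K)%:E)%E.
  elim: T => [|T IH]; first by rewrite big_ord0 add0e.
  rewrite big_ord_recr/= -addeA; apply: le_trans IH; apply: leeD => //.
  by rewrite addeC; exact: pot_step.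
apply: le_trans; under eq_integral do rewrite -sumEFin.
rewrite ge0_integral_sum//; last 2 first.
- by move=> t; by apply: (@measurable_wrt_EFin t); exact: measurable_wrt_alive_visit.
- by move=> t w _; rewrite lee_fin; exact: alive_visit_ge0.
by rewrite leeDl//; apply: integral_ge0 => w _; rewrite lee_fin.
Qed.

End Occupation.

Section Escape.
Variables (W : {fset V}) (o y0 : V) (A : nat -> set Omega) (K L M : R).
Hypotheses (oW : o \in W) (y0W : y0 \notin W) (K0 : 0 <= K) (L0 : 0 <= L)
  (KM : K < M).
Hypotheses (FA : forall t, F t (A t)).
Hypothesis AK : forall t w, A t w -> local_variation W t w <= K.
Hypothesis AL : forall w, A 0%N w -> g W o 0%N w o - g W o 0%N w (X 0%N w) <= L.
Hypothesis AM : forall w, A 0%N w -> M <= g W o 0%N w o.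

Let S : set V := [set y | y \in W /\ y != o].
Let B t := alive A S t.

(** The walk leaves W at time t+1 without a previous visit to o. *)
Definition alive_exit (A : nat -> set Omega) (W : {fset V}) (o : V) t : set Omega :=
  alive A [set y | y \in W /\ y != o] t `&` [set w | X t.+1 w \notin W].

Let Q t := alive_exit A W o t.
(* The weight rho is known at time 0 and keeps the voltages rho * v_t bounded,
   whereas v_0(o) has no upper bound; so the integrals below can be subtracted. *)
Let rho w := (1 + g W o 0%N w o)^-1.
Let h t w y := g W o t w o - g W o t w y.
Let wt t w := \1_(B t) w * rho w.
(* The factor 2 is there because v_t(o) and v_t(X_t) both move with the weights. *)
Let pot t w := wt t w * (h t w (X t w) + 2 * (K - local_variation W t w)).
Let out t w := \1_(Q t) w * (rho w * (g W o 0%N w o - K)).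

Let Bcur t w : B t w -> [/\ A t w, A 0%N w, X t w \in W & X t w != o].
Proof.
move=> Bw; have [Aw [XW Xo]] := alive_cur Bw; split => //.
by have [] := Bw 0%N (leq0n t).
Qed.

Let g_ge0 t w y : 0 <= g W o t w y.
Proof. by apply: green_ge0 y0W => //; exact: nw. Qed.

Let h_ge0 t w y : 0 <= h t w y.
Proof. by rewrite subr_ge0; apply: (green_le_diag hfin hconn o _ _ y0W) => //; exact: nw. Qed.

Let rho_gt0 w : 0 < rho w.
Proof. by rewrite invr_gt0; apply: ltr_pwDl => //; exact: g_ge0. Qed.

Let wt_ge0 t w : 0 <= wt t w.
Proof. by rewrite mulr_ge0 ?indic_ge0// ltW. Qed.

Let wtB t w : ~ B t w -> wt t w = 0.
Proof. by move=> nB; rewrite /wt indicE memNset// mul0r. Qed.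

Let bud_ge0 t w : 0 <= wt t w * (2 * (K - local_variation W t w)).
Proof.
have [Bw|nB] := pselect (B t w); last by rewrite wtB// mul0r.
have [Aw _ _ _] := Bcur Bw.
by rewrite mulr_ge0// mulr_ge0// subr_ge0; exact: AK.
Qed.

Let pot_ge0 t w : 0 <= pot t w.
Proof. by rewrite /pot mulrDr addr_ge0 ?bud_ge0// mulr_ge0. Qed.

Let mg s t y : (s <= t)%N -> Fm t (fun w => g W o s w y).
Proof.
move=> st; apply: (measurable_wrt_le st).
exact: (measurable_wrt_green hsimple hfin hconn aw _ _ y0W).
Qed.

Let mgX s t : (s <= t)%N -> Fm t (fun w => g W o s w (X t w)).
Proof. by move=> st; apply: (measurable_wrt_green_X hsimple hfin hconn aw o st y0W). Qed.

Let mh s t : (s <= t)%N -> Fm t (fun w => h s w (X t w)).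
Proof. by move=> st; apply: measurable_wrtB; [exact: mg|exact: mgX]. Qed.

Let mrho t : Fm t rho.
Proof.
apply: measurable_inv; last by move=> w; rewrite gt_eqF// -invr_gt0; exact: rho_gt0.
by apply: measurable_wrtD; [exact: measurable_wrt_cst|exact: mg].
Qed.

Let mwt t : Fm t (wt t).
Proof. by apply: measurable_wrtM; [exact: measurable_wrt_alive|exact: mrho]. Qed.

Let mbud t : Fm t (fun w => 2 * (K - local_variation W t w)).
Proof.
apply: measurable_wrtM; first exact: measurable_wrt_cst.
by apply: measurable_wrtB; [exact: measurable_wrt_cst|exact: measurable_wrt_local_variation].
Qed.

Let FQ t : F t.+1 (Q t).
Proof.
apply: (F_setI aw); last exact: (aw_X aw t.+1 [set y | y \notin W]).
by apply: (aw_mono aw); exact: F_alive.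
Qed.

Let mout t : Fm t.+1 (out t).
Proof.
apply: measurable_wrtM; first by apply: measurable_wrt_indic; [exact: (aw_sigma aw)|exact: FQ].
apply: measurable_wrtM; first exact: mrho.
by apply: measurable_wrtB; [exact: mg|exact: measurable_wrt_cst].
Qed.

Let out_ge0 t w : 0 <= out t w.
Proof.
rewrite /out indicE; case: (boolP (_ \in _)) => [|_]; last by rewrite mul0r.
rewrite inE => -[/Bcur[_ /AM Aw _ _] _]; rewrite mul1r mulr_ge0 ?(ltW (rho_gt0 w))//.
by rewrite subr_ge0 (le_trans (ltW KM)).
Qed.

Let wt_bound t w : wt t w * g W o t w o <= 1 + K.
Proof.
have [Bw|nB] := pselect (B t w); last by rewrite wtB// mul0r addr_ge0.
have [/AK bK _ _ _] := Bcur Bw.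
have := green_local_variation t w o y0W oW; rewrite ler_norml => /andP[_ gb].
rewrite /wt indicE mem_set// mul1r /rho ler_pdivrMl; last first.
  by rewrite -invr_gt0; exact: rho_gt0.
have := g_ge0 0%N w o; have := K0; move: gb bK.
move: (g W o t w o) (g W o 0%N w o) (local_variation W t w) => u v b; nra.
Qed.

(* A step from a vertex of W other than o keeps the means of v_t and of the
   constant v_t(o), hence that of their difference. *)
Let h_integral t :
  (\int[P]_w (wt t w * h t w (X t w))%:E = \int[P]_w (wt t w * h t w (X t.+1 w))%:E)%E.
Proof.
have E0 : (\int[P]_w (wt t w * g W o t w (X t w))%:E =
    \int[P]_w (wt t w * g W o t w (X t.+1 w))%:E)%E.
  rewrite (drift hsimple hfin hconn aw o y0W (@mwt t))//; last first.
    by move=> w XW; rewrite wtB// => /Bcur[_ _]; rewrite (negbTE XW).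
  rewrite [X in (_ + X)%E]integral0_eq ?adde0// => w _; congr EFin.
  have [Bw|nB] := pselect (B t w); last by rewrite wtB// mul0r.
  by have [_ _ _ /negbTE ->] := Bcur Bw; rewrite mul0r mulr0.
have mgo : Fm t.+1 (fun w => wt t w * g W o t w o).
  by apply: measurable_wrtM; [apply: (measurable_wrt_mono aw); exact: mwt|exact: mg].
have fin : (\int[P]_w (wt t w * g W o t w (X t w))%:E)%E \is a fin_num.
  rewrite ge0_fin_numE; last by apply: integral_ge0 => w _; rewrite lee_fin mulr_ge0.
  apply: (@le_lt_trans _ _ (1 + K)%:E); last exact: ltry.
  apply: integral_le_cst => [|w].
    by apply: (@measurable_wrt_EFin t); apply: measurable_wrtM; [exact: mwt|exact: mgX].
  rewrite mulr_ge0//= (le_trans _ (wt_bound t w))// ler_wpM2l//.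
  by rewrite -subr_ge0; exact: h_ge0.
have split (Y : Omega -> V) : Fm t.+1 (fun w => g W o t w (Y w)) ->
    (\int[P]_w (wt t w * g W o t w (Y w))%:E + \int[P]_w (wt t w * h t w (Y w))%:E =
     \int[P]_w (wt t w * g W o t w o)%:E)%E.
  move=> mY; have mwt1 : Fm t.+1 (wt t) by apply: (measurable_wrt_mono aw); exact: mwt.
  rewrite -ge0_integralD//.
  - by apply: eq_integral => w _; rewrite -EFinD -mulrDr /h addrC subrK.
  - by move=> w _; rewrite lee_fin mulr_ge0.
  - by apply: (@measurable_wrt_EFin t.+1); exact: measurable_wrtM.
  - by move=> w _; rewrite lee_fin mulr_ge0.
  - apply: (@measurable_wrt_EFin t.+1); apply: measurable_wrtM => //.
    by apply: measurable_wrtB => //; exact: mg.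
apply: (addeI_fin fin); rewrite split; last by apply: (measurable_wrt_mono aw); exact: mgX.
by rewrite E0 split//; exact: mgX.
Qed.

Let pot_step t :
  (\int[P]_w (pot t.+1 w)%:E + \int[P]_w (out t w)%:E <= \int[P]_w (pot t w)%:E)%E.
Proof.
have mwt1 : Fm t.+1 (wt t) by apply: (measurable_wrt_mono aw); exact: mwt.
have mbud1 : Fm t.+1 (fun w => 2 * (K - local_variation W t w)).
  by apply: (measurable_wrt_mono aw); exact: mbud.
have -> : (\int[P]_w (pot t w)%:E =
    \int[P]_w (wt t w * h t w (X t.+1 w) + wt t w * (2 * (K - local_variation W t w)))%:E)%E.
  under eq_integral do rewrite /pot mulrDr EFinD.
  under [RHS]eq_integral do rewrite EFinD.
  rewrite ge0_integralD//; last 4 first.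
  - by move=> w _; rewrite lee_fin mulr_ge0.
  - by apply: (@measurable_wrt_EFin t); apply: measurable_wrtM; [exact: mwt|exact: mh].
  - by move=> w _; rewrite lee_fin.
  - by apply: (@measurable_wrt_EFin t); apply: measurable_wrtM; [exact: mwt|exact: mbud].
  rewrite ge0_integralD//; last 4 first.
  - by move=> w _; rewrite lee_fin mulr_ge0.
  - by apply: (@measurable_wrt_EFin t.+1); apply: measurable_wrtM => //; exact: mh.
  - by move=> w _; rewrite lee_fin.
  - by apply: (@measurable_wrt_EFin t.+1); exact: measurable_wrtM.
  by rewrite h_integral.
have mpot1 : Fm t.+1 (pot t.+1).
  by apply: measurable_wrtM; [exact: mwt|apply: measurable_wrtD; [exact: mh|exact: mbud]].
rewrite -ge0_integralD//; last 4 first.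
- by move=> w _; rewrite lee_fin.
- exact: (@measurable_wrt_EFin t.+1).
- by move=> w _; rewrite lee_fin.
- exact: (@measurable_wrt_EFin t.+1).
apply: ge0_le_integral => //.
- by move=> w _; rewrite -EFinD lee_fin addr_ge0.
- by apply: emeasurable_funD; exact: (@measurable_wrt_EFin t.+1).
- apply: (@measurable_wrt_EFin t.+1).
  by apply: measurable_wrtD; apply: measurable_wrtM => //; exact: mh.
move=> w _; rewrite -EFinD lee_fin -mulrDr.
have [Bw|nB] := pselect (B t w); last first.
  rewrite /pot !wtB//; last by move=> Bw; apply: nB; exact: (alive_mono (leqnSn t) Bw).
  by rewrite !mul0r add0r /out indicE memNset ?mul0r// => -[].
have [Aw A0w XW Xo] := Bcur Bw.
have := AK Aw; have := local_variation_ge0 W t w; have := local_variationS W t w.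
have := green_local_variation t w o y0W oW; rewrite ler_norml => /andP[go _].
have wE : wt t w = rho w by rewrite /wt indicE mem_set// mul1r.
have := ltW (rho_gt0 w); rewrite wE.
have [XW'|XW'] := boolP (X t.+1 w \in W).
  rewrite /out indicE memNset ?mul0r ?addr0; last by move=> [_ /=]; rewrite XW'.
  have [Bw'|nB'] := pselect (B t.+1 w); last first.
    move=> r0 _ b0 bK; rewrite /pot wtB// mul0r mulr_ge0// addr_ge0//.
    by rewrite mulr_ge0// subr_ge0.
  move=> r0 bS b0 bK; rewrite /pot /wt indicE mem_set// mul1r ler_wpM2l//.
  rewrite bS /h.
  have := green_stable hfin hconn (X t.+1 w) (nw t w) (nw t.+1 w) y0W oW.
  have := green_stable hfin hconn o (nw t w) (nw t.+1 w) y0W oW.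
  by rewrite !ler_norml => /andP[? ?] /andP[? ?]; lra.
move=> r0 bS b0 bK; rewrite /pot wtB; last by move=> /Bcur[_ _]; rewrite (negbTE XW').
rewrite mul0r add0r /out indicE mem_set//= mul1r ler_wpM2l//.
by rewrite /h [X in _ - X + _](green_out _ _ _ XW') subr0; lra.
Qed.

(** At an exit from W the height v_t(o) - v_t(X_t+1) equals v_t(o), which is at least
v_0(o) - K; weighted by rho, its mean cannot exceed that of the initial
potential, in which the height is at most L. *)
Lemma exit_bound T :
  (\sum_(t < T) P (alive_exit A W o t) <= ((L + 2 * K) / (M - K))%:E)%E.
Proof.
have MK : 0 < M - K by rewrite subr_gt0.
have M1 : 0 < 1 + M by move: K0 KM; lra.
have pot0 : (\int[P]_w (pot 0%N w)%:E <= ((L + 2 * K) / (1 + M))%:E)%E.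
  apply: integral_le_cst.
    apply: (@measurable_wrt_EFin 0); apply: measurable_wrtM; first exact: mwt.
    by apply: measurable_wrtD; [exact: mh|exact: mbud].
  move=> w; rewrite pot_ge0/= /pot.
  have [Bw|nB] := pselect (B 0%N w); last first.
    by rewrite wtB// mul0r divr_ge0// ?(ltW M1)// addr_ge0// mulr_ge0.
  have [_ A0w _ _] := Bcur Bw.
  rewrite /wt indicE mem_set// mul1r mulrC ler_pM//.
  - by rewrite addr_ge0// mulr_ge0// /local_variation big_ord0 subr0.
  - exact: ltW.
  - by rewrite lerD ?AL// /local_variation big_ord0 subr0.
  - rewrite /rho lef_pV2 ?posrE//; first by rewrite lerD2l AM.
    by rewrite -invr_gt0; exact: rho_gt0.
have S0 : (\sum_(t < T) \int[P]_w (out t w)%:E + \int[P]_w (pot T w)%:E <=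
    ((L + 2 * K) / (1 + M))%:E)%E.
  elim: T => [|T IH]; first by rewrite big_ord0 add0e.
  rewrite big_ord_recr/= -addeA; apply: le_trans IH; apply: leeD => //.
  by rewrite addeC; exact: pot_step.
have mQ t : measurable (Q t) by apply: (aw_sub aw (t := t.+1)); exact: FQ.
have outP t : (((M - K) / (1 + M))%:E * P (Q t) <= \int[P]_w (out t w)%:E)%E.
  have -> : P (Q t) = P (Q t `&` setT) by rewrite setIT.
  have mi : measurable_fun setT (EFin \o (\1_(Q t) : Omega -> R)).
    by apply/measurable_EFinP; exact: measurable_indic.
  have k0 : (0 <= ((M - K) / (1 + M))%:E)%E by rewrite lee_fin divr_ge0// ltW.
  rewrite -integral_indic// -(ge0_integralZl P measurableT mi _ k0)//; last first.
    by move=> w _; rewrite lee_fin.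
  apply: ge0_le_integral => //.
  - by move=> w _; rewrite -EFinM lee_fin mulr_ge0// divr_ge0// ltW.
  - by apply/measurable_EFinP; apply: measurable_funM => //; exact: measurable_indic.
  - exact: (@measurable_wrt_EFin t.+1).
  move=> w _; rewrite -EFinM lee_fin /out indicE mulrC.
  case: (boolP (_ \in _)) => [|_]; last by rewrite !mul0r.
  rewrite inE => -[/Bcur[_ /AM Aw _ _] _]; rewrite !mul1r /rho [leRHS]mulrC.
  rewrite ler_pdivrMr// mulrAC ler_pdivlMr; last by rewrite -invr_gt0; exact: rho_gt0.
  by move: Aw K0 KM; move: (g W o 0%N w o) => u; nra.
have : (((M - K) / (1 + M))%:E * \sum_(t < T) P (Q t) <= ((L + 2 * K) / (1 + M))%:E)%E.
  rewrite ge0_sume_distrr//; apply: le_trans S0.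
  apply: (@le_trans _ _ (\sum_(t < T) \int[P]_w (out t w)%:E)%E); first exact: lee_sum.
  by rewrite leeDl//; apply: integral_ge0 => w _; rewrite lee_fin.
rewrite -lee_pdivlMl ?divr_gt0// -EFinM => /le_trans; apply.
rewrite lee_fin le_eqVlt; apply/orP; left; apply/eqP; field.
by rewrite !gt_eqF.
Qed.

End Escape.

End Supermartingales.

(** * Almost sure consequences *)

Lemma infinite_nat_ge (S : set nat) : infinite_set S -> forall T, exists2 t, (T <= t)%N & S t.
Proof.
move=> infS T; apply: contrapT => nex; apply: infS.
apply: (sub_finite_set _ (finite_II T)) => t St /=.
by rewrite ltnNge; apply/negP => Tt; apply: nex; exists t.
Qed.

Lemma count_unbounded (R : realType) (b : pred nat) : infinite_set [set t | b t] ->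
  forall N : nat, exists T : nat, N%:R <= \sum_(t < T) (b t)%:R :> R.
Proof.
move=> infb; elim => [|N [T NT]]; first by exists 0%N; rewrite big_ord0.
have [t Tt /= bt] := infinite_nat_ge infb T.
exists t.+1; rewrite big_ord_recr/= bt -natr1 lerD//.
apply: (le_trans NT); rewrite (big_ord_widen _ (fun t => (b t)%:R) Tt) big_mkcond/=.
by apply: ler_sum => i _; case: ifP.
Qed.

Section AlmostSure.
Variables (R : realType) (d : measure_display) (Omega : measurableType d).
Variables (P : probability Omega R) (V : choiceType) (adj : rel V).
Hypotheses (hsimple : simple_graph adj) (hfin : locally_finite adj)
  (hconn : connected_graph adj).
Variables (F : nat -> set (set Omega)) (X : nat -> Omega -> V)
  (C : nat -> Omega -> {fset V} -> R).
Hypothesis aw : adapted_walk P adj F X C.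

Local Notation Fm t := (@measurable_wrt R d Omega (F t)).
Local Notation nw := (@network_walk R d Omega P V adj hsimple F X C aw).
Local Notation c t w := (conductance adj (C t w)).
Local Notation g W x t w := (green adj (c t w) W x).
Local Notation variation := (local_variation adj C).

(** The bound K is uniform in W: this is what a finite Gamma provides. *)
Definition variation_bounded : Prop :=
  {ae P, forall w, exists K : R, forall W t, variation W t w <= K}.

Section FiniteVisits.
Variables (Wn : nat -> {fset V}) (x : V).
Hypotheses (Wmono : forall m n, (m <= n)%N -> (Wn m `<=` Wn n)%fset).
Hypotheses (xW : forall n, x \in Wn n) (Wproper : forall n, exists y, y \notin Wn n).

(* The bounds are imposed for all n at once, so that the events alive for W_n
   increase with n and monotone convergence applies. *)
Let A (k : nat) t := \bigcap_n ([set w | variation (Wn n) t w <= k%:R] `&`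
                                [set w | g (Wn n) x 0%N w x <= k%:R]).

Let FA k t : F t (A k t).
Proof.
apply: (F_bigcap aw) => n; have [y yW] := Wproper n; apply: (F_setI aw).
  apply: (measurable_wrt_leP aw); last exact: measurable_wrt_cst.
  exact: (measurable_wrt_local_variation aw).
apply: (F_monoL aw (leq0n t)); apply: (measurable_wrt_leP aw); last exact: measurable_wrt_cst.
exact: (measurable_wrt_green hsimple hfin hconn aw _ _ yW).
Qed.

Let f k n w : R := \sum_(t < n) alive_visit adj X C (A k) (Wn n) x t w.

Let f_nd k w m n : (m <= n)%N -> f k m w <= f k n w.
Proof.
move=> mn; rewrite /f (big_ord_widen _ (fun t => alive_visit adj X C (A k) (Wn m) x t w) mn).
rewrite big_mkcond/=; apply: ler_sum => t _; case: ifP => _; last first.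
  exact: (alive_visit_ge0 hsimple aw).
rewrite /alive_visit; apply: ler_wpM2r.
  by rewrite mulr_ge0// invr_ge0; apply: wdeg_ge0; exact: nw.
rewrite !indicE; case: (boolP (w \in alive _ _ [set` Wn m] _)) => [|//].
rewrite inE => Bw; rewrite mem_set// => r rt; have [Ar Xr] := Bw r rt; split => //.
exact: (fsubsetP (Wmono mn)).
Qed.

Let int_f k n : (\int[P]_w (f k n w)%:E <= (k%:R + k%:R)%:E)%E.
Proof.
have [y yW] := Wproper n.
apply: (occupation_bound (A := A k) hsimple hfin hconn aw (xW n) yW) => //.
- by move=> t w /(_ n I)[].
- by move=> w /(_ n I)[].
Qed.

Let N k : set Omega := [set w | [/\ forall n, g (Wn n) x 0%N w x <= k%:R,
  forall n t, variation (Wn n) t w <= k%:R, forall t, wdeg adj (c t w) x <= k%:R,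
  forall t, exists n, X t w \in Wn n & infinite_set [set t | X t w = x]]].

Let N_negligible k : {ae P, forall w, ~ N k w}.
Proof.
pose h w : \bar R := limn (fun n => (f k n w)%:E).
have mf n : measurable_fun setT (fun w => (f k n w)%:E).
  apply: measurableT_comp => //; apply: measurable_sum => t.
  apply: (measurable_wrt_measurable (aw_sigma aw t) (@aw_sub _ _ _ _ _ _ _ _ _ aw t)).
  by apply: (measurable_wrt_alive_visit hsimple hfin hconn aw); exact: FA.
have f0 n w : 0 <= f k n w by apply: sumr_ge0 => t _; exact: (alive_visit_ge0 hsimple aw).
have nd w : {homo (fun n => (f k n w)%:E) : m n / (m <= n)%N >-> (m <= n)%E}.
  by move=> m n mn; rewrite lee_fin f_nd.
have hsup w : h w = ereal_sup (range (fun n => (f k n w)%:E)).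
  by apply/cvg_lim => //; exact: ereal_nondecreasing_cvgn.
have ih : (\int[P]_w h w < +oo)%E.
  have g0 n w : [set: Omega] w -> (0 <= (f k n w)%:E)%E by move=> _; rewrite lee_fin f0.
  rewrite (monotone_convergence P measurableT mf g0 (fun w _ => @nd w)).
  apply: (@le_lt_trans _ _ (k%:R + k%:R)%:E); last exact: ltry.
  apply: lime_le; last by near=> n; exact: int_f.
  apply: ereal_nondecreasing_is_cvgn => m n mn.
  by apply: ge0_le_integral => // w _; rewrite ?lee_fin// f_nd.
have h0 w : (0 <= h w)%E.
  rewrite hsup (@le_trans _ _ (f k 0%N w)%:E) ?lee_fin//.
  by apply: ereal_sup_ubound; exists 0%N.
have inth : P.-integrable setT h.
  apply/integrableP; split.
    apply: (emeasurable_fun_cvg (fun n w => (f k n w)%:E)) => // w _.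
    by rewrite hsup; exact: ereal_nondecreasing_cvgn.
  by under eq_integral do rewrite gee0_abs//.
have := integrable_ae measurableT inth.
apply: filterS => w /(_ I) hfinite [gk bk dk cov inf].
have fr n : f k n w <= fine (h w).
  by rewrite -lee_fin fineK// hsup; apply: ereal_sup_ubound; exists n.
have [y yW] := Wproper 0%N.
have xy : y != x by apply: contraNneq yW => ->.
have cnt T : \sum_(t < T) (X t w == x)%:R <= fine (h w) * k%:R.
  have [n [Tn XW]] : exists n, (T <= n)%N /\ forall t, (t < T)%N -> X t w \in Wn n.
    elim: T => [|T [n [Tn XW]]]; first by exists 0%N.
    have [m Xm] := cov T; exists (maxn T.+1 (maxn m n)); split; first exact: leq_maxl.
    move=> t; rewrite ltnS leq_eqVlt => /orP[/eqP ->|/XW].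
      by apply: (fsubsetP (Wmono _)) Xm; rewrite leq_max leq_max leqnn orbT.
    by apply: (fsubsetP (Wmono _)); rewrite leq_max leq_max leqnn !orbT.
  apply: (@le_trans _ _ (f k n w * k%:R)); last by rewrite ler_wpM2r.
  rewrite /f (le_trans (y := \sum_(t < n | (t < T)%N) (X t w == x)%:R))//.
    by rewrite (big_ord_widen _ (fun t => (X t w == x)%:R) Tn).
  rewrite mulr_suml big_mkcond/=; apply: ler_sum => t _.
  have v0 : 0 <= alive_visit adj X C (A k) (Wn n) x t w by exact: (alive_visit_ge0 hsimple aw).
  case: ifP => tT; last by rewrite mulr_ge0.
  have Bt : alive X (A k) [set` Wn n] t w.
    move=> r rt; split; last by apply: XW; exact: leq_ltn_trans tT.
    by move=> i _; split; [exact: bk|exact: gk].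
  rewrite /alive_visit indicE mem_set// mul1r -mulrA ler_peMr//.
  have dp : 0 < wdeg adj (c t w) x by exact: (wdeg_gt0 hfin hconn (nw t w) xy).
  by rewrite ler_pdivlMl// mulr1.
have inf' : infinite_set [set t | X t w == x].
  by move=> fin; apply: inf; apply: sub_finite_set fin => t /= ->.
have [T] := count_unbounded R inf' (Num.bound (fine (h w) * k%:R)).
have hk0 : 0 <= fine (h w) * k%:R by rewrite mulr_ge0// fine_ge0.
by move=> /le_trans/(_ (cnt T)); rewrite leNgt archi_boundP.
Unshelve. all: by end_near. Qed.

(** By occupation_bound and monotone convergence the sum over all times of the
weighted visits to x is almost surely finite, once the bounds are localized at an
integer k; the conductances at x being bounded, this leaves finitely many visits. *)
Lemma finite_visits : variation_bounded ->
  {ae P, forall w, exists L : R, forall n, g (Wn n) x 0%N w x <= L} ->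
  {ae P, forall w, exists D : R, forall t, wdeg adj (c t w) x <= D} ->
  {ae P, forall w, (forall t, exists n, X t w \in Wn n) ->
     finite_set [set t | X t w = x]}.
Proof.
move=> hG hL hD.
have /ae_foralln hN : forall k, {ae P, forall w, ~ N k w} by [].
have hDN : {ae P, forall w, (exists D : R, forall t, wdeg adj (c t w) x <= D) /\
    forall k, ~ N k w} by move: hD hN; apply: filterS2.
move: hG hL hDN; apply: filterS3 => w [K HK] [L HL] [[D HD] HN] cov.
apply: contrapT => inf.
pose k := Num.bound `|Num.max K (Num.max L D)|.
have bk : Num.max K (Num.max L D) <= k%:R.
  by rewrite (le_trans (ler_norm _))// ltW// archi_boundP.
apply: (HN k); split => //.
- by move=> n; rewrite (le_trans (HL n))// (le_trans _ bk)// !le_max lexx orbT.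
- by move=> n t; rewrite (le_trans (HK _ t))// (le_trans _ bk)// !le_max lexx.
- by move=> t; rewrite (le_trans (HD t))// (le_trans _ bk)// !le_max lexx !orbT.
Qed.

End FiniteVisits.

Section NoEscape.
Variables (Bn : nat -> {fset V}) (o : V).
Hypotheses (Bmono : forall m n, (m <= n)%N -> (Bn m `<=` Bn n)%fset).
Hypotheses (oB : forall n, o \in Bn n) (Bproper : forall n, exists y, y \notin Bn n).
Hypothesis Bcover : forall y, exists n, y \in Bn n.

Let A (k : nat) (M : R) n t : set Omega :=
  [set w | variation (Bn n) t w <= k%:R] `&`
  ([set w | g (Bn n) o 0%N w o - g (Bn n) o 0%N w (X 0%N w) <= k%:R] `&`
   [set w | M <= g (Bn n) o 0%N w o]).

Let FA k M n t : F t (A k M n t).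
Proof.
have [y yB] := Bproper n; have mg0 z : Fm 0 (fun w => g (Bn n) o 0%N w z).
  exact: (measurable_wrt_green hsimple hfin hconn aw _ _ yB).
apply: (F_setI aw).
  apply: (measurable_wrt_leP aw); last exact: measurable_wrt_cst.
  exact: (measurable_wrt_local_variation aw).
apply: (F_monoL aw (leq0n t)); apply: (F_setI aw).
  apply: (measurable_wrt_leP aw); last exact: measurable_wrt_cst.
  apply: measurable_wrtB; first exact: mg0.
  exact: (measurable_wrt_green_X hsimple hfin hconn aw o (leqnn 0) yB).
by apply: (measurable_wrt_leP aw); [exact: measurable_wrt_cst|exact: mg0].
Qed.

Let U k M n : set Omega := \bigcup_t alive_exit X (A k M n) (Bn n) o t.

Let mE k M n t : measurable (alive_exit X (A k M n) (Bn n) o t).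
Proof.
apply: (aw_sub aw (t := t.+1)); apply: (F_setI aw).
  by apply: (aw_mono aw); apply: (F_alive aw); exact: FA.
exact: (aw_X aw t.+1 [set y | y \notin Bn n]).
Qed.

Let mU k M n : measurable (U k M n).
Proof. by apply: bigcup_measurable => t _; exact: mE. Qed.

Let PU (k : nat) (M : R) n : k%:R < M ->
  (P (U k M n) <= ((k%:R + 2 * k%:R) / (M - k%:R))%:E)%E.
Proof.
move=> kM; have [y yB] := Bproper n.
apply: (@le_trans _ _ (\sum_(0 <= t <oo) P (alive_exit X (A k M n) (Bn n) o t))%E).
  by apply: measure_sigma_subadditive => //; exact: mU.
apply: lime_le; first by apply: is_cvg_nneseries.
near=> T; rewrite big_mkord.
apply: (exit_bound hsimple hfin hconn aw (oB n) yB _ _ kM (FA k M n)) => //.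
- by move=> t w [].
- by move=> w [_ []].
- by move=> w [_ []].
Unshelve. all: by end_near. Qed.

(* The lower limit of the exit events: for large n the starting point is in B_n
   and the effective resistance from o exceeds M. *)
Let Z k M : set Omega := \bigcup_m \bigcap_n U k M (m + n)%N.

Let mZ k M : measurable (Z k M).
Proof.
apply: bigcup_measurable => m _; apply: bigcap_measurable; first by exists 0%N.
by move=> n _; exact: mU.
Qed.

Let PZ (k : nat) (M : R) : k%:R < M ->
  (P (Z k M) <= ((k%:R + 2 * k%:R) / (M - k%:R))%:E)%E.
Proof.
move=> kM; pose J m := \bigcap_n U k M (m + n)%N.
have mJ m : measurable (J m).
  by apply: bigcap_measurable; [exists 0%N|move=> n _; exact: mU].
have := @nondecreasing_cvg_mu _ _ _ P J mJ (mZ k M).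
have ndJ : nondecreasing_seq J.
  move=> m n mn; apply/subsetPset => w Jw i _.
  by have := Jw (n - m + i)%N I; rewrite addnA subnKC.
move=> /(_ ndJ) /cvg_lim <-//; apply: lime_le.
  apply: ereal_nondecreasing_is_cvgn => m n mn; rewrite le_measure ?inE//.
  exact/subsetPset/ndJ.
near=> m; apply: le_trans (PU m kM); rewrite le_measure ?inE//.
by move=> w /(_ 0%N I); rewrite addn0.
Unshelve. all: by end_near. Qed.

Let N (k : nat) : set Omega := [set w | [/\
  forall n t, variation (Bn n) t w <= k%:R,
  forall n, g (Bn n) o 0%N w o - g (Bn n) o 0%N w (X 0%N w) <= k%:R,
  forall M : R, exists n, M <= g (Bn n) o 0%N w o,
  forall t, X t w != o & forall n, exists t, X t w \notin Bn n]].

Let NZ k M : N k `<=` Z k M.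
Proof.
move=> w [bk hk unb no esc].
have [m0 Mm0] := unb M; have [m1 Xm1] := Bcover (X 0%N w).
exists (maxn m0 m1) => // i _.
have XB : X 0%N w \in Bn (maxn m0 m1 + i)%N.
  by apply: (fsubsetP (Bmono _)) Xm1; rewrite (leq_trans (leq_maxr m0 m1))// leq_addr.
have MB : M <= g (Bn (maxn m0 m1 + i)%N) o 0%N w o.
  have [y yB] := Bproper (maxn m0 m1 + i)%N.
  apply: (le_trans Mm0); apply: (green_mono hfin hconn o o (nw 0%N w) yB).
  by apply: Bmono; rewrite (leq_trans (leq_maxl m0 m1))// leq_addr.
move: (maxn m0 m1 + i)%N XB MB => n XB MB.
(* the first exit from B_n *)
case: (ex_minnP (esc n)) => -[|s] Xs smin; first by rewrite XB in Xs.
exists s => //; split => //= r rs; split; first by split; [exact: bk|split; [exact: hk|]].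
split; last exact: no.
by apply/negPn/negP => /smin; rewrite ltnNge rs.
Qed.

Let N_negligible k : {ae P, forall w, ~ N k w}.
Proof.
pose M (j : nat) : R := k%:R + j.+1%:R.
have kM j : k%:R < M j by rewrite ltrDl.
have P0 : P (\bigcap_j Z k (M j)) = 0%E.
  have mI : measurable (\bigcap_j Z k (M j)).
    by apply: bigcap_measurable; [exists 0%N|move=> j _; exact: mZ].
  have Pj j : (P (\bigcap_j Z k (M j)) <= ((k%:R + 2 * k%:R) / j.+1%:R)%:E)%E.
    have := PZ (kM j); rewrite [M j - _]addrC /M addKr => /(le_trans _); apply.
    by rewrite le_measure ?inE// => w /(_ j I).
  have fP : P (\bigcap_j Z k (M j)) \is a fin_num by exact: fin_num_measure.
  have fPj j : fine (P (\bigcap_j Z k (M j))) <= (k%:R + 2 * k%:R) / j.+1%:R.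
    by rewrite -lee_fin fineK.
  apply/eqP; rewrite eq_le measure_ge0 andbT -(fineK fP) lee_fin.
  apply/ler_addgt0Pr => e e0; rewrite add0r.
  have k3 : 0 <= (k%:R + 2 * k%:R) / e :> R by rewrite divr_ge0 ?addr_ge0 ?mulr_ge0// ltW.
  apply: (le_trans (fPj (Num.bound ((k%:R + 2 * k%:R) / e)))).
  rewrite ler_pdivrMr// -ler_pdivrMl// mulrC ltW// (lt_trans (archi_boundP k3))//.
  by rewrite ltr_nat.
exists (\bigcap_j Z k (M j)); split => //.
  by apply: bigcap_measurable; [exists 0%N|move=> j _; exact: mZ].
by move=> w /= /contrapT Nw j _; exact: NZ.
Qed.

(** By exit_bound the walk leaves B_n before a visit to o with probability of order
1/M as soon as the effective resistance from o to the complement of B_n exceeds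
M, and M is arbitrary. *)
Lemma no_escape : variation_bounded ->
  {ae P, forall w, forall M : R, exists n, M <= g (Bn n) o 0%N w o} ->
  {ae P, forall w, ~ ((forall t, X t w != o) /\ forall n, exists t, X t w \notin Bn n)}.
Proof.
move=> hG hunb.
have /ae_foralln hN : forall k, {ae P, forall w, ~ N k w} by [].
move: hG hunb hN; apply: filterS3 => w [K HK] unb HN [no esc].
have [p [pth pl]] := hconn o (X 0%N w).
pose L := path_resistance (c 0%N w) o p.
pose k := Num.bound `|Num.max K L|.
have bk : Num.max K L <= k%:R.
  by rewrite (le_trans (ler_norm _))// ltW// archi_boundP.
apply: (HN k); split => //.
- by move=> n t; rewrite (le_trans (HK _ t))// (le_trans _ bk)// !le_max lexx.
- move=> n; have [y yB] := Bproper n; rewrite -pl.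
  rewrite (le_trans (green_path_le hfin hconn o (nw 0%N w) yB pth))//.
  by rewrite (le_trans _ bk)// !le_max lexx orbT.
Qed.

End NoEscape.

End AlmostSure.

(** * Balls, and quantification over all vertices *)

Section Balls.
Variables (V : choiceType) (adj : rel V).
Hypotheses (hfin : locally_finite adj) (hconn : connected_graph adj).

Fixpoint graph_ball (o : V) n : {fset V} :=
  if n is n'.+1 then nbhd adj (graph_ball o n') else [fset o]%fset.

Lemma graph_ball_center o n : o \in graph_ball o n.
Proof.
by elim: n => [|n IH] /=; [rewrite in_fset1|exact: (fsubsetP (sub_nbhd adj _))].
Qed.

Lemma graph_ball_mono o m n : (m <= n)%N -> (graph_ball o m `<=` graph_ball o n)%fset.
Proof.
move=> /subnK <-; elim: (n - m)%N => [|k IH]; first exact: fsubset_refl.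
exact: fsubset_trans IH (sub_nbhd adj _).
Qed.

Lemma graph_ball_cover o y : exists n, y \in graph_ball o n.
Proof.
have [p [pth <-]] := hconn o y.
suff H a n : a \in graph_ball o n -> path adj a p -> last a p \in graph_ball o (n + size p)%N.
  by exists (0 + size p)%N; exact: (H o 0%N (graph_ball_center o 0)).
elim: p {pth} a n => [|b p IH] a n an /=; first by move=> _; rewrite addn0.
move=> /andP[ab pth].
rewrite addnS -addSn; apply: IH => //=.
by apply: (fsubsetP (nb_sub_nbhd adj an)); rewrite (in_nb hfin).
Qed.

(** The balls around o enumerate the vertices, so the graph is countable. *)
Lemma ae_forall_vertex (R : realType) d (Omega : measurableType d)
    (P : probability Omega R) (o : V) (Q : V -> Omega -> Prop) :
  (forall v, {ae P, forall w, Q v w}) -> {ae P, forall w, forall v, Q v w}.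
Proof.
move=> hQ.
have : {ae P, forall w, forall n i, Q (nth o (graph_ball o n) i) w}.
  by apply/ae_foralln => n; apply/ae_foralln => i; exact: hQ.
apply: filterS => w Qw v; have [n vn] := graph_ball_cover o v.
by have := Qw n (index v (graph_ball o n)); rewrite nth_index.
Qed.

Definition finite_graph o : Prop := exists n, forall y, y \in graph_ball o n.

Lemma infinite_graphP o : ~ finite_graph o -> forall n, exists y, y \notin graph_ball o n.
Proof.
move=> nfin n; apply: contrapT => nex; apply: nfin; exists n => y.
by apply/negPn/negP => yn; apply: nex; exists y.
Qed.

Lemma leaves_finite (x : nat -> V) (B : {fset V}) :
  (forall v, finite_set [set t | x t = v]) -> exists t, x t \notin B.
Proof.
move=> fv; apply: contrapT => nex; apply: infinite_nat.
apply: (sub_finite_set (B := \bigcup_(v in [set` B]) [set t | x t = v])).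
  move=> t _; exists (x t) => //=; apply/negPn/negP => xt; apply: nex.
  by exists t.
by apply: bigcup_finite; [exact: finite_fset|move=> v _; exact: fv].
Qed.

End Balls.

(** * Recurrence and transience from effective resistances *)

Section Shift.
Variables (R : realType) (d : measure_display) (Omega : measurableType d).
Variables (P : probability Omega R) (V : choiceType) (adj : rel V).
Variables (F : nat -> set (set Omega)) (X : nat -> Omega -> V)
  (C : nat -> Omega -> {fset V} -> R).
Hypothesis aw : adapted_walk P adj F X C.

Lemma adapted_walk_shift s : adapted_walk P adj (fun t => F (t + s)%N)
  (fun t => X (t + s)%N) (fun t => C (t + s)%N).
Proof.
split.
- by move=> t; exact: (aw_sigma aw).
- by move=> t; exact: (aw_sub aw).
- by move=> t; exact: (aw_mono aw (t := (t + s)%N)).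
- by move=> t; exact: (aw_X aw).
- by move=> t; exact: (aw_C aw).
- by move=> t; exact: (aw_pos aw).
- by move=> t; exact: (aw_step aw).
Qed.

Lemma local_variation_shift s W t w :
  local_variation adj (fun t => C (t + s)%N) W t w <= local_variation adj C W (t + s)%N w.
Proof.
elim: t => [|t IH]; first by rewrite {1}/local_variation big_ord0; exact: local_variation_ge0.
by rewrite addSn !local_variationS lerD.
Qed.

Lemma variation_bounded_shift s : variation_bounded P adj C ->
  variation_bounded P adj (fun t => C (t + s)%N).
Proof.
apply: filterS => w [K HK]; exists K => W t.
exact: le_trans (local_variation_shift s W t w) (HK _ _).
Qed.

End Shift.

Section RecurrenceTransience.
Variables (R : realType) (V : choiceType) (adj : rel V).
Hypotheses (hsimple : simple_graph adj) (hfin : locally_finite adj)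
  (hconn : connected_graph adj).

Definition bounded_wdeg d (Omega : measurableType d) (P : probability Omega R)
    (C : nat -> Omega -> {fset V} -> R) : Prop :=
  forall x, {ae P, forall w, exists D : R, forall t, wdeg adj (conductance adj (C t w)) x <= D}.

(** The effective resistance between o and the complement of a ball around it. *)
Definition ball_green (C : {fset V} -> R) o n : R :=
  green adj (conductance adj C) (graph_ball adj o n) o o.

Section Fixed.
Variables (d : measure_display) (Omega : measurableType d) (P : probability Omega R).

(** Before a visit to o the walk lives in the balls without o, from which any x has
effective resistance at most that of a path to o.  So a walk that avoids o
visits every vertex finitely often by finite_visits and leaves every finite set;
this is absurd in a finite graph, and contradicts no_escape in an infinite one. *)
Lemma ae_hits (F : nat -> set (set Omega)) X C o : adapted_walk P adj F X C ->
  variation_bounded P adj C -> bounded_wdeg P C ->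
  finite_graph adj o \/
    {ae P, forall w, forall M : R, exists n, M <= ball_green (C 0%N w) o n} ->
  {ae P, forall w, exists t, X t w = o}.
Proof.
move=> aw hG hdeg hunb.
have fin_visits : {ae P, forall w, forall x, (forall t, X t w != o) ->
    finite_set [set t | X t w = x]}.
  apply: (ae_forall_vertex hfin hconn o) => x.
  have [->|xo] := eqVneq x o.
    apply: aeW => w no; rewrite (_ : [set t | _] = set0) //.
    by apply/seteqP; split => // t /= Xt; have := no t; rewrite Xt eqxx.
  have [r xr] := graph_ball_cover hfin hconn o x.
  pose Wn n := (graph_ball adj o (n + r)%N `\ o)%fset.
  have xW n : x \in Wn n.
    by rewrite in_fsetD1 xo/=; apply: (fsubsetP (graph_ball_mono adj o _)) xr; exact: leq_addl.
  have Wmono m n : (m <= n)%N -> (Wn m `<=` Wn n)%fset.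
    by move=> mn; apply: fsetSD; apply: graph_ball_mono; rewrite leq_add2r.
  have oW n : o \notin Wn n by rewrite in_fsetD1 eqxx.
  have := finite_visits hsimple hfin hconn aw Wmono xW (fun n => ex_intro _ o (oW n)) hG.
  have hL : {ae P, forall w, exists L : R, forall n,
      green adj (conductance adj (C 0%N w)) (Wn n) x x <= L}.
    apply: aeW => w; have [p [pth pl]] := hconn x o.
    exists (path_resistance (conductance adj (C 0%N w)) x p) => n.
    have := green_path_le hfin hconn x (network_walk hsimple aw 0%N w) (oW n) pth.
    by rewrite pl (green_out _ _ _ (oW n)) subr0.
  move=> /(_ hL (hdeg x)); apply: filterS => w + no; apply => t.
  have [m Xm] := graph_ball_cover hfin hconn o (X t w); exists m.
  rewrite in_fsetD1 no/=; apply: (fsubsetP (graph_ball_mono adj o _)) Xm; exact: leq_addr.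
have [[n hn]|infV] := pselect (finite_graph adj o).
  apply: filterS fin_visits => w fv; apply: contrapT => nhit.
  have [|t] := @leaves_finite V (X ^~ w) (graph_ball adj o n); last by rewrite hn.
  by move=> v; apply: fv => t; apply/eqP => Xt; apply: nhit; exists t.
case: hunb => [//|hunb].
have := no_escape hsimple hfin hconn aw (@graph_ball_mono V adj o) (graph_ball_center adj o)
  (infinite_graphP infV) (graph_ball_cover hfin hconn o) hG hunb.
move: fin_visits; apply: filterS2 => w fv nesc; apply: contrapT => nhit.
have no t : X t w != o by apply/eqP => Xt; apply: nhit; exists t.
by apply: nesc; split => // n; apply: leaves_finite => v; exact: fv.
Qed.

Lemma unbounded_shift (F : nat -> set (set Omega)) X C o s : adapted_walk P adj F X C ->
  variation_bounded P adj C -> ~ finite_graph adj o ->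
  {ae P, forall w, forall M : R, exists n, M <= ball_green (C 0%N w) o n} ->
  {ae P, forall w, forall M : R, exists n, M <= ball_green (C s w) o n}.
Proof.
move=> aw hG infV; move: hG; apply: filterS2 => w [K HK] unb M.
have [n Mn] := unb (M + K); exists n.
have [y yB] := infinite_graphP infV n.
have := green_local_variation hsimple hfin hconn aw s w o yB (graph_ball_center adj o n).
by move: Mn (HK (graph_ball adj o n) s); rewrite /ball_green ler_norml => + + /andP[]; lra.
Qed.

Lemma infinitely_many_visits (F : nat -> set (set Omega)) X C o :
  adapted_walk P adj F X C -> variation_bounded P adj C -> bounded_wdeg P C ->
  finite_graph adj o \/
    {ae P, forall w, forall M : R, exists n, M <= ball_green (C 0%N w) o n} ->
  {ae P, forall w, infinite_set [set t | X t w = o]}.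
Proof.
move=> aw hG hdeg hunb.
have : {ae P, forall w, forall s, exists t, X (t + s)%N w = o}.
  apply/ae_foralln => s; apply: (ae_hits (adapted_walk_shift aw s)).
  - exact: variation_bounded_shift.
  - by move=> x; apply: filterS (hdeg x) => w [D HD]; exists D.
  - have [fg|infV] := pselect (finite_graph adj o); first by left.
    by case: hunb => [//|hunb]; right; exact: (unbounded_shift s aw).
apply: filterS => w hit fin.
have [N HN] : exists N, forall t, X t w = o -> (t < N)%N.
  have /finite_seqP[l lE] := fin.
  exists (\max_(t <- l) t).+1 => t Xt; rewrite ltnS.
  have tl : t \in l by have : [set t | X t w = o] t by []; rewrite lE.
  by rewrite (big_rem t)//= leq_maxl.
by have [t /HN] := hit N; rewrite ltnNge leq_addl.
Qed.

Lemma finitely_many_visits (F : nat -> set (set Omega)) X C o :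
  adapted_walk P adj F X C -> variation_bounded P adj C -> bounded_wdeg P C ->
  ~ finite_graph adj o ->
  {ae P, forall w, exists L : R, forall n, ball_green (C 0%N w) o n <= L} ->
  {ae P, forall w, finite_set [set t | X t w = o]}.
Proof.
move=> aw hG hdeg infV hL.
have := finite_visits hsimple hfin hconn aw (@graph_ball_mono V adj o) (graph_ball_center adj o)
  (infinite_graphP infV) hG hL (hdeg o).
by apply: filterS => w; apply => t; exact: graph_ball_cover.
Qed.

End Fixed.

End RecurrenceTransience.

Lemma ae_not_false (R : realType) d (Omega : measurableType d)
    (P : probability Omega R) : ~ {ae P, forall w : Omega, False}.
Proof.
move=> H; have : P [set: Omega] = 0%E.
  apply: measure_negligible => //; by apply: negligibleS H => w _ [].
by rewrite probability_setT => /eqP; rewrite onee_eq0.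
Qed.

(** * The weighted random walk with constant weights *)

Section MarkovChain.
Variables (R : realType) (V : choiceType) (adj : rel V).
Hypotheses (hsimple : simple_graph adj) (hfin : locally_finite adj)
  (hconn : connected_graph adj).
Variables (C : {fset V} -> R) (Cpos : forall e, edges adj e -> 0 < C e).
Variables (d : measure_display) (Omega : measurableType d) (P : probability Omega R).
Variables (X : nat -> Omega -> V) (o : V).
Hypothesis mc : markov_chain P X (trans_prob adj C) o.

(** The events determined by the trajectory up to time t, described as those that
contain, with a sample point, all the points with the same trajectory: closure
under the operations of a sigma-algebra is then immediate. *)
Definition path_events t : set (set Omega) :=
  [set A | forall w w', (forall s, (s <= t)%N -> X s w = X s w') -> A w -> A w'].

Lemma path_events_sigma t : sigma_algebra setT (path_events t).
Proof.
split => [//|A mA|A mA].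
  by move=> w w' ww' [_ nA]; split => // Aw'; apply: nA; apply: mA Aw' => s /ww'.
by move=> w w' ww' [i _ Aw]; exists i => //; exact: mA Aw.
Qed.

Definition vertex_code v : nat :=
  let n := projT1 (cid (graph_ball_cover hfin hconn o v)) in
  choice.pickle (n, index v (graph_ball adj o n)).

Lemma vertex_code_inj : injective vertex_code.
Proof.
move=> u v; rewrite /vertex_code; case: cid => n /= un; case: cid => m /= vm.
move=> /(pcan_inj choice.pickleK)[nm]; rewrite -nm in vm *.
by move=> /(congr1 (nth o (graph_ball adj o n))); rewrite !nth_index.
Qed.

(** Numbers the trajectories up to time t, to cut an event into countably many
pieces on each of which the trajectory is constant. *)
Definition path_code t w : nat := choice.pickle [seq vertex_code (X s w) | s <- iota 0 t.+1].

Lemma path_codeP t w w' :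
  path_code t w = path_code t w' <-> forall s, (s <= t)%N -> X s w = X s w'.
Proof.
split => [/(pcan_inj choice.pickleK)/eq_in_map H s st|H].
  by apply: vertex_code_inj; apply: H; rewrite mem_iota add0n.
congr choice.pickle; apply/eq_in_map => s; rewrite mem_iota add0n ltnS => /andP[_ /H ->] //.
Qed.

Let cell t k : set Omega := [set w | path_code t w = k].

Let mX t U : measurable (X t @^-1` U).
Proof. by have [mX _ _] := mc; exact: mX. Qed.

Let traj t (u : nat -> V) : set Omega := [set w | forall s, (s <= t)%N -> X s w = u s].

Let m_traj t u : measurable (traj t u).
Proof.
rewrite (_ : traj t u = \bigcap_s [set w | (s <= t)%N -> X s w = u s]).
  apply: bigcap_measurable; first by exists 0%N.
  move=> s _; case: (leqP s t) => st.
    rewrite (_ : mkset _ = X s @^-1` [set u s]); first exact: mX.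
    by apply/seteqP; split => w /=; [apply|].
  rewrite (_ : mkset _ = setT); first exact: measurableT.
  by apply/seteqP; split.
by apply/seteqP; split => [w Hw s _ /=|w Hw s st]; [exact: Hw|exact: Hw].
Qed.

Let cell_traj t w : cell t (path_code t w) = traj t (fun s => X s w).
Proof.
by apply/seteqP; split => w' /=; [move=> /path_codeP|move=> H; apply/path_codeP].
Qed.

Let cellI A t k : path_events t A ->
  A `&` cell t k = set0 \/ exists2 w, A w & A `&` cell t k = traj t (fun s => X s w).
Proof.
move=> FA; have [[w [Aw kw]]|nex] := pselect (exists w, (A `&` cell t k) w); last first.
  by left; apply/seteqP; split => // w Aw; apply: nex; exists w.
right; exists w => //; rewrite -kw -cell_traj; apply/seteqP; split => [w' []//|w' H].
by split => //; apply: FA Aw; move: H => /path_codeP H s /H.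
Qed.

Let m_cellI A t k : path_events t A -> measurable (A `&` cell t k).
Proof. by move=> /(cellI k)[->|[w _ ->]]; [exact: measurable0|exact: m_traj]. Qed.

Let cell_cover A t : A = \bigcup_k (A `&` cell t k).
Proof.
by apply/seteqP; split => [w Aw|w [k _ []]//]; exists (path_code t w).
Qed.

Lemma path_events_measurable t : path_events t `<=` measurable.
Proof.
move=> A FA; rewrite (cell_cover A t).
by apply: bigcup_measurable => k _; exact: m_cellI.
Qed.

Lemma path_events_X s t U : (s <= t)%N -> path_events t (X s @^-1` U).
Proof. by move=> st w w' /(_ s st) /= ->. Qed.

(** On a piece where the trajectory is constant, the transition probability is a
constant and the identity is the Markov property. *)
Lemma markov_step t y :
  is_cond_prob P (path_events t) [set w | X t.+1 w = y]
    (fun w => trans_prob adj C (X t w) y).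
Proof.
split.
  move=> S _; rewrite (_ : _ @^-1` S = X t @^-1` [set x | S (trans_prob adj C x y)])//.
  exact: path_events_X.
move=> A FA; rewrite (cell_cover A t) setI_bigcupl.
have my : measurable [set w | X t.+1 w = y] by exact: (mX t.+1 [set y]).
have p0 w : (0 <= (trans_prob adj C (X t w) y)%:E)%E.
  by rewrite lee_fin trans_prob_ge0.
have mp : measurable_fun setT (fun w => (trans_prob adj C (X t w) y)%:E).
  apply/measurable_EFinP => _ B mB; rewrite setTI.
  exact: (mX t [set x | B (trans_prob adj C x y)]).
have trivc : trivIset setT (fun k => A `&` cell t k).
  by move=> i j _ _ [w [[_ /= <-] [_ /= <-]]].
rewrite ge0_integral_bigcup//; last 2 first.
- by move=> k; exact: m_cellI.
- exact: measurable_funS mp.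
rewrite measure_bigcup//; last 2 first.
- by move=> k _; apply: measurableI => //; exact: m_cellI.
- by apply: trivIset_setIr.
rewrite [RHS](@eq_eseriesl _ _ xpredT); last by move=> i; rewrite in_setT.
apply: eq_eseriesr => k _.
have [->|[w Aw ->]] := cellI k FA.
  by rewrite integral_set0 set0I measure0.
have [_ _ mk] := mc.
pose u s := if (s <= t)%N then X s w else y.
have E1 : traj t u = traj t (fun s => X s w).
  by apply/seteqP; split => w' H s st; have := H s st; rewrite /u st.
have E2 : traj t.+1 u = traj t (fun s => X s w) `&` [set w | X t.+1 w = y].
  apply/seteqP; split => w' /=.
    move=> H; split; last by have := H t.+1 (leqnn _); rewrite /u ltnn.
    by move=> s st; have := H s (leqW st); rewrite /u st.
  move=> [H Hy] s; rewrite leq_eqVlt => /orP[/eqP ->|]; first by rewrite /u ltnn.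
  by rewrite ltnS => st; rewrite /u st; exact: H.
have := mk t u; rewrite -/(traj t.+1 u) -/(traj t u) E1 E2 => E3; apply: (etrans _ (esym E3)).
rewrite (eq_integral (cst (trans_prob adj C (X t w) y)%:E)); last first.
  by move=> w'; rewrite inE => /(_ t (leqnn t)) /= ->.
rewrite integral_cst//.
by rewrite muleC /u leqnn ltnn.
Qed.

Lemma markov_adapted : adapted_walk P adj path_events X (fun _ _ => C).
Proof.
split.
- exact: path_events_sigma.
- exact: path_events_measurable.
- by move=> t A FA w w' H; apply: FA => s st; apply: H; exact: leqW.
- by move=> t U; exact: path_events_X.
- by move=> t e he B mB w w' _.
- by [].
- exact: markov_step.
Qed.

Lemma markov_variation_bounded : variation_bounded P adj (fun (_ : nat) (_ : Omega) => C).
Proof.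
apply: aeW => w; exists 0 => W t; rewrite /local_variation big1// => r _.
by rewrite /resistance_dist big1// => a _; rewrite big1// => b _; rewrite subrr normr0.
Qed.

Lemma markov_bounded_wdeg : bounded_wdeg adj P (fun (_ : nat) (_ : Omega) => C).
Proof. by move=> x; apply: aeW => w; exists (wdeg adj (conductance adj C) x). Qed.

(** With bounded resistances o would be visited finitely often. *)
Lemma chain_finite_visits L : ~ finite_graph adj o ->
  (forall n, ball_green adj C o n <= L) -> ~ recurrent P X.
Proof.
move=> infV hL rec.
have := finitely_many_visits hsimple hfin hconn markov_adapted markov_variation_bounded
  markov_bounded_wdeg infV (aeW _ (fun w => ex_intro _ L hL)).
move: rec; rewrite /recurrent => rec fin; apply: (@ae_not_false R _ _ P).
by move: rec fin; apply: filterS2 => w /(_ o).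
Qed.

(** With unbounded resistances o would be visited infinitely often. *)
Lemma chain_infinite_visits :
  finite_graph adj o \/ (forall M : R, exists n, M <= ball_green adj C o n) ->
  ~ transient P X.
Proof.
move=> unb tr.
have inf : {ae P, forall w, infinite_set [set t | X t w = o]}.
  apply: (infinitely_many_visits hsimple hfin hconn markov_adapted markov_variation_bounded
    markov_bounded_wdeg); case: unb => [|unb]; [by left|right].
  exact: aeW.
apply: (@ae_not_false R _ _ P).
by move: tr inf; apply: filterS2 => w /(_ o).
Qed.

End MarkovChain.

Section Dichotomy.
Variables (R : realType) (V : choiceType) (adj : rel V).
Hypotheses (hsimple : simple_graph adj) (hfin : locally_finite adj)
  (hconn : connected_graph adj).
Variables (C : {fset V} -> R) (Cpos : forall e, edges adj e -> 0 < C e).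

Lemma walk_recurrent_green o : walk_recurrent adj C -> ~ finite_graph adj o ->
  forall M : R, exists n, M <= ball_green adj C o n.
Proof.
move=> /(_ o) [dO [T [Q [X [mc rec]]]]] infV M.
apply: contrapT => nex; apply: (chain_finite_visits hsimple hfin hconn Cpos mc infV _ rec).
by move=> n; rewrite leNgt; apply/negP => /ltW Mn; apply: nex; exists n; exact: Mn.
Qed.

Lemma walk_transient_green o : walk_transient adj C ->
  ~ finite_graph adj o /\ exists L : R, forall n, ball_green adj C o n <= L.
Proof.
move=> /(_ o) [dO [T [Q [X [mc tr]]]]].
have nunb := chain_infinite_visits hsimple hfin hconn Cpos mc.
split; first by move=> fg; apply: nunb tr; left.
apply: contrapT => nb; apply: nunb tr; right => M.
apply: contrapT => nex; apply: nb; exists M => n.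
by rewrite leNgt; apply/negP => /ltW Mn; apply: nex; exists n.
Qed.

End Dichotomy.

(** * The variation near a finite set is at most twice Gamma *)

Section Variation.
Variables (R : realType) (V : choiceType) (adj : rel V).

Definition edge_set (N : {fset V}) : {fset {fset V}} :=
  [fset e in flatten [seq [seq [fset p; q]%fset | q <- N & adj p q] | p <- N]]%fset.

Lemma edge_setP (N : {fset V}) e : e \in edge_set N ->
  exists a b, adj a b /\ e = [fset a; b]%fset.
Proof.
rewrite in_fset => /flatten_mapP[a _ /mapP[b]].
by rewrite mem_filter => /andP[ab _] ->; exists a, b.
Qed.

Lemma mem_edge_set (N : {fset V}) a b : a \in N -> b \in N -> adj a b ->
  [fset a; b]%fset \in edge_set N.
Proof.
move=> aN bN ab; rewrite in_fset; apply/flatten_mapP; exists a => //.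
by apply/mapP; exists b => //; rewrite mem_filter ab.
Qed.

Lemma sum_pred1_le1 (N : {fset V}) a : \sum_(x <- N) (x == a)%:R <= 1 :> R.
Proof. exact: (@sum_delta_le1 V R N predT a). Qed.

Lemma fset2_eq (a b x y : V) : [fset a; b]%fset = [fset x; y]%fset ->
  (x == a) && (y == b) \/ (x == b) && (y == a).
Proof.
move=> E.
have := fset21 x y; have := fset22 x y; rewrite -E => /fset2P yab /fset2P xab.
have := fset21 a b; have := fset22 a b; rewrite E => /fset2P bxy /fset2P axy.
by move: xab yab axy bxy => [->|->] [->|->] [|] ? [|] ?; subst; rewrite ?eqxx; auto.
Qed.

(** An edge comes from at most two ordered pairs of vertices. *)
Lemma sum_orientations (N : {fset V}) (f : {fset V} -> R) : (forall e, 0 <= f e) ->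
  \sum_(a <- N) \sum_(b <- N | adj a b) f [fset a; b]%fset <=
  2 * \sum_(e <- edge_set N) f e.
Proof.
move=> f0.
have -> : \sum_(a <- N) \sum_(b <- N | adj a b) f [fset a; b]%fset =
    \sum_(a <- N) \sum_(b <- N) \sum_(e <- edge_set N)
      (adj a b && (e == [fset a; b]%fset))%:R * f e.
  rewrite big_seq [RHS]big_seq; apply: eq_bigr => a aN.
  rewrite big_mkcond/= big_seq [RHS]big_seq; apply: eq_bigr => b bN.
  case: ifPn => [ab|nab]/=; last by rewrite big1// => e _; rewrite mul0r.
  have abE := mem_edge_set aN bN ab.
  rewrite (bigD1_seq _ abE (fset_uniq _))/=.
  by rewrite eqxx mul1r big1 ?addr0// => e /negbTE ->; rewrite mul0r.
have -> : \sum_(a <- N) \sum_(b <- N) \sum_(e <- edge_set N)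
      (adj a b && (e == [fset a; b]%fset))%:R * f e =
    \sum_(e <- edge_set N) (\sum_(a <- N) \sum_(b <- N)
      (adj a b && (e == [fset a; b]%fset))%:R) * f e.
  under eq_bigr do rewrite exchange_big/=.
  rewrite exchange_big/=; apply: eq_bigr => e _; rewrite mulr_suml.
  by apply: eq_bigr => a _; rewrite mulr_suml.
rewrite mulr_sumr big_seq [leRHS]big_seq; apply: ler_sum => e eN.
apply: ler_wpM2r => //; have [a0 [b0 [_ ->]]] := edge_setP eN.
have prod1 u v : \sum_(a <- N) \sum_(b <- N) (a == u)%:R * (b == v)%:R <= 1 :> R.
  under eq_bigr do rewrite -mulr_sumr.
  rewrite -mulr_suml mulr_ile1// ?sum_pred1_le1//; exact: sumr_ge0.
rewrite -[2]/(1 + 1); apply: (le_trans _ (lerD (prod1 a0 b0) (prod1 b0 a0))).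
rewrite -big_split/=; apply: ler_sum => a _; rewrite -big_split/=; apply: ler_sum => b _.
rewrite -!natrM -natrD ler_nat !mulnb.
case: (boolP (adj a b && _)) => // /andP[_ /eqP/fset2_eq[->|->]] //.
by rewrite addn1.
Qed.

Lemma local_variation_le d (Omega : measurableType d) (C : nat -> Omega -> {fset V} -> R) W t w :
  ((local_variation adj C W t w)%:E <= 2%:E * resistance_variation adj C w)%E.
Proof.
pose f r e := `|(C r w e)^-1 - (C r.+1 w e)^-1|.
pose E := edge_set (nbhd adj W).
have step r : resistance_dist adj W (conductance adj (C r w)) (conductance adj (C r.+1 w)) <=
    2 * \sum_(e <- E) f r e.
  rewrite /resistance_dist.
  apply: (le_trans _ (sum_orientations _ (f := f r) (fun e => normr_ge0 _))).
  apply: ler_sum => a _; rewrite le_eqVlt; apply/orP; left; apply/eqP.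
  by apply: eq_bigr => b ab; rewrite /conductance ab.
have E2 : ((\sum_(r < t) \sum_(e <- E) f r e)%:E <= resistance_variation adj C w)%E.
  rewrite /resistance_variation; apply: esum_ge.
  exists (`I_t `*` [set` E]).
    split; first by apply: finite_setX; [exact: finite_II|exact: finite_fset].
    by move=> x [_ /edge_setP[a [b [ab xE]]]]; split => //; exists a, b.
  rewrite -(pair_fsbig _ (fun r e => (f r e)%:E)); [|exact: finite_II|exact: finite_fset].
  rewrite -fsbig_ord -sumEFin.
  by apply: lee_sum => i _; rewrite fsbig_finite ?set_fsetK ?sumEFin//; exact: finite_fset.
rewrite -(@lee_pmul2l _ 2%:E)// in E2.
by apply: (le_trans _ E2); rewrite -EFinM lee_fin mulr_sumr; apply: ler_sum => r _.
Qed.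

End Variation.

(** * Random walks in changing environment *)

Section FromRWCE.
Variables (R : realType) (d : measure_display) (Omega : measurableType d).
Variables (P : probability Omega R) (V : choiceType) (adj : rel V).
Variables (X : nat -> Omega -> V) (C : nat -> Omega -> {fset V} -> R).

Lemma RWCE_adapted : is_RWCE P adj X C -> proper_RWCE adj C ->
  adapted_walk P adj (history adj X C) X C.
Proof.
move=> [mX mC _ step] Cpos; split => //.
- by move=> t; exact: smallest_sigma_algebra.
- move=> t; apply: smallest_sub; first exact: sigma_algebra_measurable.
  move=> A [s [_ [[U ->]|[e [B [he mB ->]]]]]]; first exact: mX.
  by rewrite -[X in measurable X]setTI; exact: mC.
- move=> t; apply: sub_sigma_algebra2 => A [s [st H]]; exists s; split => //.
  exact: leqW.
- by move=> t U; apply: sub_sigma_algebra; exists t; split => //; left; exists U.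
- move=> t e he B mB; apply: sub_sigma_algebra; exists t; split => //; right.
  by exists e, B.
Qed.

Lemma RWCE_variation_bounded :
  {ae P, forall w, (resistance_variation adj C w < +oo)%E} -> variation_bounded P adj C.
Proof.
apply: filterS => w Gfin; have G0 : (0 <= resistance_variation adj C w)%E.
  by apply: esum_ge0 => i _; rewrite lee_fin.
exists (2 * fine (resistance_variation adj C w)) => W t.
rewrite -lee_fin EFinM fineK ?ge0_fin_numE//; exact: local_variation_le.
Qed.

Lemma RWCE_bounded_wdeg : locally_finite adj -> bounded_from_above P adj C ->
  bounded_wdeg adj P C.
Proof.
move=> hfin hbdd x; apply: filterS hbdd => w supC.
pose D e : R := fine (ereal_sup [set (C t w e)%:E | t in [set: nat]]).
have CD t e : edges adj e -> C t w e <= D e.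
  move=> he; have ub : ((C t w e)%:E <= ereal_sup [set (C t w e)%:E | t in [set: nat]])%E.
    by apply: ereal_sup_ubound; exists t.
  rewrite -lee_fin fineK// fin_numElt supC// andbT.
  exact: lt_le_trans (ltNyr _) ub.
exists (\sum_(y <- nb adj x) D [fset x; y]%fset) => t.
rewrite /wdeg big_seq [leRHS]big_seq; apply: ler_sum => y.
by rewrite (in_nb hfin) => xy; rewrite /conductance xy CD//; exact: edge_of.
Qed.

End FromRWCE.

Unset Implicit Arguments.

Theorem theorem2p1 (V : choiceType) (adj : rel V)
    (hsimple : simple_graph adj) (hfin : locally_finite adj)
    (hconn : connected_graph adj)
    (R : realType) (d : measure_display) (Omega : measurableType d)
    (P : probability Omega R)
    (X : nat -> Omega -> V) (C : nat -> Omega -> {fset V} -> R)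
    (hRWCE : is_RWCE P adj X C) (hproper : proper_RWCE adj C)
    (hbdd : bounded_from_above P adj C)
    (hGamma : {ae P, forall w, (resistance_variation adj C w < +oo)%E}) :
  ({ae P, forall w, walk_recurrent adj (C 0%N w)} -> recurrent P X) /\
  ({ae P, forall w, walk_transient adj (C 0%N w)} -> transient P X).
Proof.
have aw := RWCE_adapted hRWCE hproper.
have hG := RWCE_variation_bounded hGamma.
have hdeg := RWCE_bounded_wdeg hfin hbdd.
pose o := X 0%N (point : Omega).
split => hC; apply: (ae_forall_vertex hfin hconn o) => v.
  apply: (infinitely_many_visits hsimple hfin hconn aw hG hdeg).
  have [fg|infV] := pselect (finite_graph adj v); [by left|right].
  by apply: filterS hC => w /(walk_recurrent_green hsimple hfin hconn (hproper 0%N w)); apply.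
have infV : ~ finite_graph adj v.
  move=> fg; apply: (@ae_not_false R _ _ P); apply: filterS hC => w.
  by move=> /(walk_transient_green hsimple hfin hconn (hproper 0%N w) v)[].
apply: (finitely_many_visits hsimple hfin hconn aw hG hdeg infV).
apply: filterS hC => w.
by move=> /(walk_transient_green hsimple hfin hconn (hproper 0%N w) v)[].
Qed.
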